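(* Consider the linear model $Y_i = x_i'\beta_0 + e_i$, $i=1,2,\dots,n$, where $x_i\in\mathbb{R}^p$ are known (non-random) design vectors, $\beta_0\in\mathbb{R}^p$ is an unknown vector of regression coefficients, and $\{e_i, i\ge 1\}$ is a sequence of independent and identically distributed real random variables. Let $\rho:\mathbb{R}\to\mathbb{R}$ be a non-monotonic convex function with left and right derivatives $\psi_-$ and $\psi_+$, and let $\psi:\mathbb{R}\to\mathbb{R}$ satisfy $\psi_-(u)\le\psi(u)\le\psi_+(u)$ for all $u\in\mathbb{R}$. Let $S_n=\sum_{i=1}^n x_i x_i'$, assume that $S_{n_0}$ is positive definite for some integer $n_0$, and for $n\ge n_0$ let $d_n=\max_{1\le i\le n} x_i' S_n^{-1} x_i$. Suppose there exist positive constants $\Delta, C_0, C_1$ such that $$\psi(u+h)-\psi(u)\le C_0\quad\text{for all } h\in(0,\Delta)\text{ and } u\in\mathbb{R},$$ $$\mathrm{E}\,\psi(e_1)=0,\qquad |\mathrm{E}\,\psi(e_1+u)|\ge C_1|u|\quad\text{for all } |u|<\Delta,$$ and suppose that $$d_n=O(n^{-1})\quad\text{as } n\to\infty.$$ For $n\ge n_0$ let $\hat\beta_n$ be the M-estimate of $\beta_0$, i.e. a minimizer over $\beta\in\mathbb{R}^p$ of $\sum_{i=1}^n\rho(Y_i-x_i'\beta)$. Then $\hat\beta_n\to\beta_0$ almost surely as $n\to\infty$.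
   Context: Vectors are column vectors and $'$ denotes transpose. The dimension $p$ is fixed, and the sequence of design vectors $x_1,x_2,\dots$ does not depend on $n$. Only $n\ge n_0$ is considered, so that $S_n$ is positive definite and invertible. ''M-estimate'' means a minimizer of the convex objective $\beta\mapsto\sum_{i=1}^n\rho(Y_i-x_i'\beta)$. *)

(* Defs.v *)
From HB Require Import structures.
From mathcomp Require Import all_boot all_order all_algebra.
From mathcomp Require Import finmap.
From mathcomp Require Import all_classical all_reals all_analysis.

Set Implicit Arguments.
Unset Strict Implicit.
Unset Printing Implicit Defensive.

Import Order.TTheory GRing.Theory Num.Theory.
Import numFieldNormedType.Exports.

Local Open Scope classical_set_scope.
Local Open Scope ring_scope.

(* Sequences of the source that are indexed by i = 1, 2, ... are indexed here  *)
(* by i = 0, 1, ...: the first n terms of a sequence are those with i < n, and *)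
(* e_1 is [e 0%N].                                                             *)

Section linear_algebra.
Context {R : realType} {p : nat}.

Definition dotcv (u v : 'cV[R]_p) : R := (u^T *m v) 0 0.

Definition posdefmx (A : 'M[R]_p) : Prop :=
  A^T = A /\ forall v : 'cV[R]_p, v != 0 -> 0 < dotcv v (A *m v).

Definition gram (x : nat -> 'cV[R]_p) (n : nat) : 'M[R]_p :=
  \sum_(i < n) x i *m (x i)^T.

(* The default value 0 of the maximum is harmless when [gram x n] is positive  *)
(* definite, all the terms being nonnegative in that case.                     *)
Definition max_leverage (x : nat -> 'cV[R]_p) (n : nat) : R :=
  \big[Num.max/0]_(i < n) dotcv (x i) (invmx (gram x n) *m x i).

Definition M_objective (rho : R -> R) (x : nat -> 'cV[R]_p) (y : nat -> R)
    (n : nat) (beta : 'cV[R]_p) : R :=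
  \sum_(i < n) rho (y i - dotcv (x i) beta).

Definition is_M_estimate (rho : R -> R) (x : nat -> 'cV[R]_p) (y : nat -> R)
    (n : nat) (b : 'cV[R]_p) : Prop :=
  forall beta : 'cV[R]_p, M_objective rho x y n b <= M_objective rho x y n beta.

End linear_algebra.

Section one_sided_derivatives.
Context {R : realType}.

Definition is_left_derivative (f df : R -> R) : Prop :=
  forall u, (f (u + h) - f u) / h @[h --> 0^'-] --> df u.

Definition is_right_derivative (f df : R -> R) : Prop :=
  forall u, (f (u + h) - f u) / h @[h --> 0^'+] --> df u.

End one_sided_derivatives.

Section iid.
Context {d : measure_display} {T : measurableType d} {R : realType}
  {P : probability T R}.

Definition mutually_independent (X : nat -> {RV P >-> R}) : Prop :=
  forall (J : {fset nat}) (A : nat -> set R), (forall i, measurable (A i)) ->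
    P (\bigcap_(i in [set` J]) (X i @^-1` A i)) =
    (\prod_(i <- J) P (X i @^-1` A i))%E.

Definition identically_distributed (X : nat -> {RV P >-> R}) : Prop :=
  forall (i j : nat) (A : set R), measurable A ->
    distribution P (X i) A = distribution P (X j) A.

End iid.

(* Main.v *)
(* With [gram x n = B^T B], the substitution [u = B (b - beta0) / sqrt n] turns *)
(* the objective into [F u = \sum_i rho (e_i - w_i^T u)], where                *)
(* [\sum_i (w_i^T u)^2 = n |u|^2] and, because the leverages are O(1/n), the   *)
(* vectors [w_i] (which depend on n) are bounded uniformly in n. By convexity  *)
(* it is enough to show [F u > F 0] on a small sphere, and by a Lipschitz      *)
(* bound on a finite net of it. Writing [t_i = w_i^T u] and using the          *)
(* subgradient inequality at [e_i] and at [e_i - t_i / 2],                     *)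
(* [F u - F 0 >= - \sum_i t_i / 2 * (psi (e_i - t_i / 2) + psi e_i)], whose    *)
(* mean is at least [C1 / 4 * \sum_i t_i^2 = C1 / 4 * n |u|^2]. As only        *)
(* [E |psi e_0| < +oo] is available and the weights form a triangular array,   *)
(* psi is truncated: the bounded part obeys an exponential inequality and      *)
(* Borel-Cantelli, and the tail a one-sided law of large numbers for           *)
(* nonnegative iid variables. Finally [b - beta0] is small as soon as [u] is,  *)
(* since [x_i^T (b - beta0) = w_i^T u] for i < n0 and [gram x n0] is           *)
(* invertible.                                                                 *)

Require Import Defs.
From HB Require Import structures.
From mathcomp Require Import all_boot all_order all_algebra.
From mathcomp Require Import finmap.
From mathcomp Require Import all_classical all_reals all_analysis.
From mathcomp Require Import measurable_realfun.
From mathcomp Require Import ring lra.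

Set Implicit Arguments.
Unset Strict Implicit.
Unset Printing Implicit Defensive.

Import Order.TTheory GRing.Theory Num.Theory.
Import numFieldNormedType.Exports.

Local Open Scope classical_set_scope.
Local Open Scope ring_scope.

(** * Linear algebra of the design *)

(** By convexity, a minimiser can lie outside a small cube around the true parameter only if the
    objective takes, somewhere on the boundary, a value not above the one at the true parameter.
    [normalized_design] supplies coordinates in which the Gram matrix is n times the identity and
    the design vectors stay bounded. In these coordinates [M_estimate_close] excludes such a
    boundary point deterministically: the increase of the objective is of order n delta^2, and every
    error is a smaller multiple of n. The quadratic increase comes from the lower bound on |E psi(e
    + u)|, made one-signed by monotonicity of psi ([drift_psi_shift]). The fluctuations are
    controlled almost surely by [score_sum_le] on a finite net, through the exponential bound
    [bounded_sum_tail], and by [iid_sum_le] for the truncation error and the Lipschitz constant.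
    [normalized_consistency] combines these, and [gram_coercive], applied to the fixed index n0,
    carries the conclusion back to beta. *)

Lemma dotcvE (R : realType) (p : nat) (u v : 'cV[R]_p) :
  dotcv u v = \sum_k u k 0 * v k 0.
Proof. by rewrite /dotcv mxE; apply: eq_bigr => k _; rewrite mxE. Qed.

Lemma dotcvC (R : realType) (p : nat) (u v : 'cV[R]_p) : dotcv u v = dotcv v u.
Proof. by rewrite !dotcvE; apply: eq_bigr => k _; rewrite mulrC. Qed.

Lemma dotcvBr (R : realType) (p : nat) (u v w : 'cV[R]_p) :
  dotcv u (v - w) = dotcv u v - dotcv u w.
Proof. by rewrite /dotcv mulmxBr !mxE. Qed.

Lemma dotcvZr (R : realType) (p : nat) (a : R) (u v : 'cV[R]_p) :
  dotcv u (a *: v) = a * dotcv u v.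
Proof. by rewrite /dotcv -scalemxAr mxE. Qed.

Lemma normr_dotcv_le (R : realType) (p : nat) (u v : 'cV[R]_p) (a b : R) :
    (forall k, `|u k 0| <= a) -> (forall k, `|v k 0| <= b) ->
  `|dotcv u v| <= p%:R * a * b.
Proof.
move=> ua vb; rewrite dotcvE (le_trans (ler_norm_sum _ _ _))//.
rewrite (le_trans (ler_sum _ (_ : forall k, _ -> _ <= a * b)))//.
  by move=> k _; rewrite normrM ler_pM.
by rewrite sumr_const card_ord -[leLHS]mulr_natl mulrA.
Qed.

Lemma posdefmx_unit (R : realType) (p : nat) (A : 'M[R]_p) :
  posdefmx A -> A \in unitmx.
Proof.
move=> [symA posA]; rewrite -row_free_unit -kermx_eq0; apply/eqP/row_matrixP => i.
rewrite row0; apply/eqP/contraT => nz.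
have /posA : (row i (kermx A))^T != 0.
  by apply: contra nz => /eqP /(congr1 trmx); rewrite trmxK trmx0 => ->.
by rewrite /dotcv trmxK mulmxA -row_mul mulmx_ker row0 mul0mx mxE ltxx.
Qed.

(** Induction on the dimension through the Schur complement of the top left entry a. The complement
    is positive definite because its form at v is the form of A at the vector [y] completing v by
    -a^-1 u v, which kills the first block of [A *m y]. *)
Lemma cholesky (R : realType) (p : nat) (A : 'M[R]_p) :
  posdefmx A -> exists B : 'M[R]_p, A = B^T *m B.
Proof.
elim: p A => [A _|p IH]; first by exists 0; rewrite [LHS]flatmx0 [RHS]flatmx0.
rewrite -[p.+1]/(1 + p)%N => A [symA posA].
set a := A 0 0; set u := ursubmx A; set D := drsubmx A.
have ulA : ulsubmx A = a%:M.
  by apply/matrixP => i j; rewrite !mxE !ord1 /= mulr1n; congr (A _ _);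
    apply/val_inj.
have dlA : dlsubmx A = u^T by rewrite -[in LHS]symA -trmx_ursub.
have symD : D^T = D by rewrite /D trmx_drsub symA.
have blockA : A = block_mx a%:M u u^T D by rewrite -ulA -dlA submxK.
have a_gt0 : 0 < a.
  have /posA : delta_mx 0 0 != 0 :> 'cV[R]_(1 + p).
    by apply/eqP => /matrixP /(_ 0 0) /eqP; rewrite !mxE eqxx oner_eq0.
  rewrite /dotcv trmx_delta -rowE -colE !mxE//.
have [B' B'E] : exists B' : 'M[R]_p, D - a^-1 *: (u^T *m u) = B'^T *m B'.
  apply: IH; split.
    by rewrite linearB /= linearZ /= trmx_mul trmxK symD.
  move=> v v0.
  set y := col_mx (- a^-1 *: (u *m v)) v.
  have Ay : A *m y = col_mx 0 ((D - a^-1 *: (u^T *m u)) *m v).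
    rewrite blockA /y mul_block_col; congr col_mx.
      by rewrite mul_scalar_mx scalerA mulrN divff ?gt_eqF// scaleN1r addNr.
    rewrite mulmxBl -scalemxAr scaleNr addrC; congr (_ - _).
    by rewrite -scalemxAl mulmxA.
  have : y != 0.
    apply: contra v0 => /eqP; rewrite -[0 in RHS](@col_mx0 _ 1 p 1).
    by move=> /eq_col_mx[_ ->].
  by move=> /posA; rewrite Ay /dotcv tr_col_mx mul_row_col mulmx0 add0r.
exists (block_mx (Num.sqrt a)%:M ((Num.sqrt a)^-1 *: u) 0 B').
have sa : Num.sqrt a != 0 by rewrite sqrtr_eq0 -ltNge.
rewrite [LHS]blockA tr_block_mx mulmx_block !trmx0 !mul0mx !addr0.
rewrite tr_scalar_mx mul_scalar_mx scale_scalar_mx -expr2 sqr_sqrtr ?ltW//.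
rewrite mul_scalar_mx scalerA divff// scale1r linearZ /= mul_mx_scalar scalerA.
rewrite divff// scale1r -scalemxAl -scalemxAr scalerA -invfM -expr2.
by rewrite sqr_sqrtr ?ltW// -B'E mulmx0 addr0 addrC subrK.
Qed.

Lemma dotcv_gram (R : realType) (p : nat) (x : nat -> 'cV[R]_p) (n : nat)
    (v : 'cV[R]_p) : dotcv v (gram x n *m v) = \sum_(i < n) dotcv (x i) v ^+ 2.
Proof.
rewrite /dotcv /gram mulmx_suml mulmx_sumr summxE; apply: eq_bigr => i _.
have -> : v^T *m (x i *m (x i)^T *m v) = v^T *m x i *m ((x i)^T *m v).
  by rewrite !mulmxA.
by rewrite [LHS]mxE big_ord1 -/(dotcv v (x i)) -/(dotcv (x i) v) dotcvC -expr2.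
Qed.

(** The quadratic form is a sum of squares, so it can only grow with the number of terms. *)
Lemma gram_posdef (R : realType) (p : nat) (x : nat -> 'cV[R]_p) (m n : nat) :
  (m <= n)%N -> posdefmx (gram x m) -> posdefmx (gram x n).
Proof.
move=> mn [_ pos]; split.
  rewrite /gram linear_sum /=; apply: eq_bigr => i _.
  by rewrite trmx_mul trmxK.
move=> v /pos; rewrite !dotcv_gram => /lt_le_trans; apply.
rewrite -!(big_mkord xpredT (fun i => dotcv (x i) v ^+ 2)).
rewrite (big_cat_nat (n := m) (p := n))//=.
by rewrite lerDl sumr_ge0// => i _; rewrite sqr_ge0.
Qed.

Lemma leverage_le_max (R : realType) (p : nat) (x : nat -> 'cV[R]_p) (n : nat)
    (i : 'I_n) :
  dotcv (x i) (invmx (gram x n) *m x i) <= max_leverage x n.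
Proof.
by apply: (le_bigmax_cond _ (fun i : 'I_n => dotcv (x i) (invmx (gram x n) *m x i))).
Qed.

(* With [gram x n = B^T B], the map [U] is [B / sqrt n] and the normalised   *)
(* design vectors are [sqrt n B^-T x i].                                     *)
Lemma normalized_design (R : realType) (p : nat) (x : nat -> 'cV[R]_p) (n : nat)
    (C : R) :
    (0 < n)%N -> posdefmx (gram x n) -> max_leverage x n <= C / n%:R ->
  exists (w : nat -> 'cV[R]_p) (U : 'M[R]_p),
  [/\ forall i v, dotcv (w i) (U *m v) = dotcv (x i) v,
      forall v, \sum_(i < n) dotcv (w i) v ^+ 2 = n%:R * dotcv v v &
      forall i, (i < n)%N -> dotcv (w i) (w i) <= C].
Proof.
move=> n_gt0 pd lev; have [B gramE] := cholesky pd.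
have unitBTB : B^T *m B \in unitmx by rewrite -gramE posdefmx_unit.
have unitB : B \in unitmx by move: unitBTB; rewrite unitmx_mul => /andP[].
have unitBT : B^T \in unitmx by rewrite unitmx_tr.
set s := Num.sqrt n%:R : R.
have s2 : s * s = n%:R by rewrite -expr2 sqr_sqrtr ?ler0n.
have s_gt0 : 0 < s by rewrite sqrtr_gt0 ltr0n.
have invgram : invmx (gram x n) = invmx B *m (invmx B)^T.
  rewrite gramE; apply: (can_inj (mulKmx unitBTB)); rewrite mulmxV//.
  by rewrite mulmxA -[B^T *m B *m _]mulmxA mulmxV// mulmx1 trmx_inv mulmxV.
exists (fun i => s *: ((invmx B)^T *m x i)), (s^-1 *: B); split.
- move=> i v; rewrite /dotcv linearZ /= trmx_mul trmxK -scalemxAl.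
  rewrite -scalemxAl -scalemxAr scalerA divff ?gt_eqF// scale1r -mulmxA.
  by rewrite mulKmx.
- move=> v; have := dotcv_gram x n (invmx B *m v); rewrite gramE.
  rewrite -mulmxA mulKVmx// /dotcv trmx_mul -mulmxA [_ *m (_ *m v)]mulmxA.
  rewrite trmx_inv mulVmx// mul1mx => ->; rewrite mulr_sumr; apply: eq_bigr => i _.
  rewrite linearZ /= trmx_mul -trmx_inv trmxK -scalemxAl mxE exprMn expr2 s2.
  by rewrite mulmxA.
- move=> i i_n; rewrite /dotcv [(s *: _)^T]linearZ /= trmx_mul trmxK.
  rewrite -scalemxAl -scalemxAr.
  rewrite scalerA s2 mxE -ler_pdivlMl ?ltr0n//.
  have := le_trans (leverage_le_max x (Ordinal i_n)) lev.
  by rewrite /dotcv invgram !mulmxA mulrC.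
Qed.

(** Expanding v = S^-1 S v gives v as the combination of the vectors S^-1 x_i with coefficients
    x_i'v. *)
Lemma gram_coercive (R : realType) (p : nat) (x : nat -> 'cV[R]_p) (n : nat) :
    posdefmx (gram x n) ->
  exists2 c : R, 0 < c & forall (v : 'cV[R]_p) (a : R),
    0 <= a -> (forall i, (i < n)%N -> `|dotcv (x i) v| <= a) ->
    forall k, `|v k 0| <= c * a.
Proof.
move=> pd; set A := invmx (gram x n).
(* The summand 1 only keeps the constant positive. *)
exists (1 + \sum_k \sum_(i < n) `|(A *m x i) k 0|).
  by rewrite ltr_pwDl// sumr_ge0// => k _; rewrite sumr_ge0.
move=> v a a_ge0 va k.
have -> : v = \sum_(i < n) dotcv (x i) v *: (A *m x i).
  rewrite -[LHS](mulKmx (posdefmx_unit pd)) -/A {1}/gram mulmx_suml mulmx_sumr.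
  apply: eq_bigr => i _; rewrite -mulmxA [(x i)^T *m v]mx11_scalar.
  by rewrite mul_mx_scalar -scalemxAr.
rewrite summxE (le_trans (ler_norm_sum _ _ _))// mulrDl mul1r.
rewrite ler_wpDl// (bigD1 k)//= mulrDl ler_wpDr//.
  by rewrite mulr_ge0// sumr_ge0// => j _; rewrite sumr_ge0.
rewrite mulr_suml ler_sum// => i _; rewrite mxE normrM mulrC ler_wpM2l//.
exact: va.
Qed.
(** * Subgradients *)

(** The chord from a to b bounds the increments of rho between them. Dividing by h and letting h
    tend to 0 from the side of b compares the chord slope with the one-sided derivative on that
    side, hence with psi a. *)
Lemma convex_subgradient (R : realType) (rho psi_m psi_p psi : R -> R) :
    @convex_function R R^o setT rho ->
    is_left_derivative rho psi_m -> is_right_derivative rho psi_p ->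
    (forall u, psi_m u <= psi u <= psi_p u) ->
  forall a b, rho a + psi a * (b - a) <= rho b.
Proof.
move=> cvx lft rgt btw a b.
have cvxE (t u v : R) : 0 <= t <= 1 ->
    rho (t * u + (1 - t) * v) <= t * rho u + (1 - t) * rho v.
  move=> /andP[t0 t1].
  have := cvx (Itv01 t0 t1) u v; rewrite !inE => /(_ I I).
  by rewrite !convRE.
(* Stating the range of h through h / (b - a) treats b < a and a < b at once. *)
have slope h : h / (b - a) \in `[0, 1] -> b != a ->
    rho (a + h) - rho a <= (rho b - rho a) / (b - a) * h.
  rewrite in_itv => h01 ba.
  have := cvxE _ b a h01; have ba0 : b - a != 0 by rewrite subr_eq0.
  have -> : h / (b - a) * b + (1 - h / (b - a)) * a = a + h by field.
  have -> : (rho b - rho a) / (b - a) * h = h / (b - a) * (rho b - rho a) by field.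
  lra.
have [ba|ab|->] := ltgtP b a; last by rewrite subrr mulr0 addr0.
- suff : (rho b - rho a) / (b - a) <= psi_m a.
    rewrite ler_ndivrMr ?subr_lt0// => le1; case/andP: (btw a) => mle _.
    have : psi a * (b - a) <= psi_m a * (b - a).
      by rewrite ler_wnM2r// subr_le0 ltW.
    lra.
  apply: (cvgr_to_ge (lft a)); near=> h.
  have h0 : h < 0 by near: h; exact: nbhs_left_lt.
  have bah : b - a <= h by near: h; apply: nbhs_left_ge; rewrite subr_lt0.
  rewrite ler_ndivlMr//; apply: slope; last by rewrite lt_eqF.
  rewrite in_itv /= ler_ndivlMr ?ler_ndivrMr ?subr_lt0//.
  by rewrite mul0r mul1r ltW.
- suff : psi_p a <= (rho b - rho a) / (b - a).
    rewrite ler_pdivlMr ?subr_gt0// => le1; case/andP: (btw a) => _ mle.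
    have : psi a * (b - a) <= psi_p a * (b - a).
      by rewrite ler_wpM2r// subr_ge0 ltW.
    lra.
  apply: (cvgr_to_le (rgt a)); near=> h.
  have h0 : 0 < h by near: h; exact: nbhs_right_gt.
  have hba : h <= b - a by near: h; apply: nbhs_right_le; rewrite subr_gt0.
  rewrite ler_pdivrMr//; apply: slope; last by rewrite gt_eqF.
  rewrite in_itv /= ler_pdivlMr ?ler_pdivrMr ?subr_gt0//.
  by rewrite mul0r mul1r ltW.
Unshelve. all: by end_near. Qed.

Lemma subgradient_nondecreasing (R : realDomainType) (rho psi : R -> R) :
  (forall a b, rho a + psi a * (b - a) <= rho b) -> nondecreasing_fun psi.
Proof.
move=> sub a b; rewrite le_eqVlt => /predU1P[->//|ab].
by have := sub a b; have := sub b a; nra.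
Qed.
(** * Expectations and independence *)

(** Since exp(-y) >= 1 - y, exp y is at most 1 / (1 - y), which the quadratic dominates on this
    range. *)
Lemma expR_le_quadratic (R : realType) (y : R) :
  `|y| <= 1 / 2 -> expR y <= 1 + y + 2 * y ^+ 2.
Proof.
rewrite ler_norml => /andP[y_ge y_le].
have y1 : 0 < 1 - y by lra.
have : expR y * (1 - y) <= 1.
  rewrite -[leRHS](expRxMexpNx_1 y) ler_pM2l ?expR_gt0//.
  exact: expR_ge1Dx.
rewrite -ler_pdivlMr// => /le_trans; apply.
by rewrite ler_pdivrMr//; nra.
Qed.

(** Integrated, this makes the Chebyshev bounds along powers of two summable under a first moment
    only. *)
Lemma truncated_sqr_sum_le (R : realFieldType) (z : R) (K : nat) :
  0 <= z -> \sum_(k < K) Num.min z (2 ^+ k) ^+ 2 / 2 ^+ k <= 4 * z.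
Proof.
move=> z_ge0.
(* The terms are 2^k as long as 2^k <= z, and z^2 / 2^k afterwards.           *)
suff [h1 h2] : (2 ^+ K <= z ->
      \sum_(k < K) Num.min z (2 ^+ k) ^+ 2 / 2 ^+ k <= 2 ^+ K) /\
    (z <= 2 ^+ K -> \sum_(k < K) Num.min z (2 ^+ k) ^+ 2 / 2 ^+ k <=
      4 * z - 2 * z ^+ 2 / 2 ^+ K).
  have p0 : 0 < 2 ^+ K :> R by rewrite exprn_gt0.
  have [zK|/ltW zK] := leP z (2 ^+ K).
    apply: le_trans (h2 zK) _; rewrite gerBl divr_ge0 ?(ltW p0)//.
    by rewrite mulr_ge0// exprn_ge0.
  by apply: le_trans (h1 zK) _; apply: le_trans zK _; rewrite ler_peMl// ler1n.
elim: K => [|K [IH1 IH2]].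
  by rewrite big_ord0 expr0 divr1; split=> [_|z1]; nra.
rewrite big_ord_recr /= exprS; set S := \sum_(_ < K) _ in IH1 IH2 *.
move: IH1 IH2; set q := 2 ^+ K => IH1 IH2.
have q0 : 0 < q by rewrite exprn_gt0.
split=> [qz|zq].
  have qz' : q <= z by lra.
  rewrite (min_idPr qz') expr2 -mulrA divff ?gt_eqF// mulr1.
  by have := IH1 qz'; lra.
have [zq'|/ltW qz'] := leP z q.
  have := IH2 zq'; suff -> : 2 * z ^+ 2 / (2 * q) = 2 * z ^+ 2 / q - z ^+ 2 / q by lra.
  by field; rewrite gt_eqF.
rewrite expr2 -mulrA divff ?gt_eqF// mulr1.
have := IH1 qz'.
suff : z ^+ 2 / q <= 4 * z - 2 * q.
  have -> : 2 * z ^+ 2 / (2 * q) = z ^+ 2 / q by field; rewrite gt_eqF.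
  lra.
by rewrite ler_pdivrMr//; nra.
Qed.

(** * Real-valued integrals under a probability measure *)

Section real_expectation.
Context (R : realType) (d : measure_display) (T : measurableType d)
  (P : probability T R).

Local Notation integrable_real f := (P.-integrable setT (EFin \o f)).

Lemma bounded_integrable (f : T -> R) (M : R) :
  measurable_fun setT f -> (forall w, `|f w| <= M) -> integrable_real f.
Proof.
move=> mf fM; apply: measurable_bounded_integrable => //.
  by apply: (le_lt_trans (probability_le1 P measurableT)); rewrite ltry.
exists M; split; first exact: num_real.
by move=> a Ma w _ /=; rewrite (le_trans (fM w))// ltW.
Qed.

Lemma integrable_realD (f g : T -> R) : integrable_real f -> integrable_real g ->
  integrable_real (fun w => f w + g w).
Proof. by move=> intf intg; exact: (integrableD measurableT intf intg). Qed.

Lemma integrable_realB (f g : T -> R) : integrable_real f -> integrable_real g ->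
  integrable_real (fun w => f w - g w).
Proof. by move=> intf intg; exact: (integrableB measurableT intf intg). Qed.

Lemma integrable_realZl (a : R) (f : T -> R) : integrable_real f ->
  integrable_real (fun w => a * f w).
Proof. by move=> intf; exact: (integrableZl measurableT a intf). Qed.

Lemma integrable_real_cst (a : R) : integrable_real (fun _ => a).
Proof. exact: finite_measure_integrable_cst. Qed.

Lemma integrable_real_sum (I : Type) (s : seq I) (f : I -> T -> R) :
  (forall i, integrable_real (f i)) ->
  integrable_real (fun w => \sum_(i <- s) f i w).
Proof.
move=> intf; elim: s => [|i s IH].
  under eq_fun do rewrite big_nil; exact: integrable_real_cst.
by under eq_fun do rewrite big_cons; exact: integrable_realD.
Qed.

Lemma Rintegral_sum (I : Type) (s : seq I) (f : I -> T -> R) :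
  (forall i, integrable_real (f i)) ->
  \int[P]_w (\sum_(i <- s) f i w) = \sum_(i <- s) \int[P]_w f i w.
Proof.
move=> intf; elim: s => [|i s IH].
  under eq_Rintegral do rewrite big_nil; rewrite Rintegral_cst// mul0r big_nil.
  by [].
under eq_Rintegral do rewrite big_cons.
by rewrite RintegralD//; [rewrite IH big_cons|exact: integrable_real_sum].
Qed.

Lemma Rintegral_prob_cst (a : R) : \int[P]_w a = a.
Proof. by rewrite Rintegral_cst// [X in fine X](probability_setT P) mulr1. Qed.

Lemma Rintegral_prob_indic (A : set T) : measurable A ->
  \int[P]_w \1_A w = fine (P A).
Proof. by move=> mA; rewrite /Rintegral integral_indic// setIT. Qed.

(** Markov's inequality in the form that serves both the exponential and the second-moment
    bounds. *)
Lemma probability_le_Rintegral (A : set T) (f : T -> R) : measurable A ->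
  integrable_real f -> (forall w, \1_A w <= f w) -> (P A <= (\int[P]_w f w)%:E)%E.
Proof.
move=> mA intf Af; rewrite -[leLHS]fineK ?fin_num_measure// lee_fin.
rewrite -Rintegral_prob_indic//; apply: le_Rintegral => //.
apply: (bounded_integrable (M := 1)); first exact: measurable_indic.
by move=> w; rewrite indicE; case: (_ \in _); rewrite /= ?normr0 ?normr1.
Qed.

Lemma borel_cantelli_bounded (B : nat -> set T) (M : R) :
    (forall n, measurable (B n)) ->
    (forall K, (\sum_(n < K) P (B n) <= M%:E)%E) ->
  {ae P, forall w, \forall n \near \oo, ~ B n w}.
Proof.
move=> mB sumB.
exists (lim_sup_set B); split.
- by apply: bigcapT_measurable => n; apply: bigcup_measurable.
- apply: lim_sup_set_cvg0 => //; apply: le_lt_trans (ltry M).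
  apply: lime_le; first exact: is_cvg_nneseries.
  by apply: nearW => K; rewrite big_mkord.
- move=> w /= nB n _; apply: contrapT => nBn; apply: nB.
  by exists n => // m /= nm Bm; apply: nBn; exists m.
Qed.

Lemma Rintegral_ident_distrib (X Y : {RV P >-> R}) (f : R -> R) :
    (forall A, measurable A -> distribution P X A = distribution P Y A) ->
    measurable_fun setT f ->
    integrable_real (f \o X) -> integrable_real (f \o Y) ->
  \int[P]_w f (X w) = \int[P]_w f (Y w).
Proof.
move=> XY mf intX intY; rewrite /Rintegral; congr fine.
have mEf : measurable_fun setT (EFin \o f) by exact/measurable_EFinP.
transitivity (\int[distribution P X]_y (f y)%:E)%E.
  by rewrite (integral_distribution mEf intX).
rewrite (eq_measure_integral (distribution P Y)).
  by rewrite (integral_distribution mEf intY).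
by move=> A mA _; exact: XY.
Qed.

Lemma integrable_ident_distrib (X Y : {RV P >-> R}) (f : R -> R) :
    (forall A, measurable A -> distribution P X A = distribution P Y A) ->
    measurable_fun setT f -> integrable_real (f \o X) -> integrable_real (f \o Y).
Proof.
move=> XY mf /integrableP[_ intX]; apply/integrableP; split.
  by apply/measurable_EFinP; exact: measurableT_comp.
have mEf : measurable_fun setT (abse \o (EFin \o f)).
  by apply: measurableT_comp => //; exact/measurable_EFinP.
have := ge0_integral_distribution Y mEf (fun y => abse_ge0 _).
rewrite (eq_measure_integral (distribution P X)); last first.
  by move=> A mA _; exact/esym/XY.
by rewrite (ge0_integral_distribution X mEf (fun y => abse_ge0 _)) => <-.
Qed.

End real_expectation.

(** * Independence, exponential tails and laws of large numbers *)

Section independence.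
Context (R : realType) (d : measure_display) (T : measurableType d)
  (P : probability T R).

Local Notation integrable_real f := (P.-integrable setT (EFin \o f)).

(* Rounding [f + M] down to a multiple of [1 / N] reduces the claim, up to an  *)
(* error of order [1 / N], to a finite linear combination of indicators.       *)
Lemma Rintegral_mul_comp (X : {RV P >-> R}) (G : T -> R) (K c : R) :
    measurable_fun setT G -> (forall w, `|G w| <= K) ->
    (forall A, measurable A ->
      \int[P]_w (G w * \1_A (X w)) = c * \int[P]_w \1_A (X w)) ->
  forall (f : R -> R) (M : R), measurable_fun setT f -> (forall y, `|f y| <= M) ->
    \int[P]_w (G w * f (X w)) = c * \int[P]_w f (X w).
Proof.
move=> mG GK indE f M mf fM.
have K_ge0 : 0 <= K by rewrite (le_trans _ (GK point)).
have M_ge0 : 0 <= M by rewrite (le_trans _ (fM 0)).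
have mX : measurable_fun setT X by [].
have intg (g : R -> R) (b : R) : measurable_fun setT g -> (forall y, `|g y| <= b) ->
    integrable_real (fun w => g (X w)).
  move=> mg gb; apply: (@bounded_integrable _ _ _ P _ (b)); last by move=> w; exact: gb.
  exact: (measurableT_comp mg mX).
have intGg (g : R -> R) (b : R) : measurable_fun setT g -> (forall y, `|g y| <= b) ->
    integrable_real (fun w => G w * g (X w)).
  move=> mg gb; apply: (@bounded_integrable _ _ _ P _ (K * b)).
    by apply: measurable_funM => //; exact: (measurableT_comp mg mX).
  by move=> w; rewrite normrM ler_pM.
have mind (A : set R) : measurable A -> measurable_fun setT (\1_A : R -> R).
  by move=> mA; exact: measurable_indic.
have ind1 (A : set R) y : `|\1_A y : R| <= 1.
  by rewrite indicE; case: (_ \in _); rewrite /= ?normr0 ?normr1.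
suff approx N : `|\int[P]_w (G w * f (X w)) - c * \int[P]_w f (X w)| <=
    (K + `|c|) * N.+1%:R^-1.
  apply/eqP; rewrite -subr_eq0 -normr_le0; apply/ler_addgt0Pr => e e0.
  rewrite add0r.
  have Kc : 0 <= K + `|c| by rewrite addr_ge0.
  apply: le_trans (approx (Num.truncn ((K + `|c|) / e))) _.
  rewrite ler_pdivrMr ?ltr0n// mulrC -ler_pdivrMr//.
  by apply/ltW; rewrite truncnS_gt.
set N1 : R := N.+1%:R; have N1_gt0 : 0 < N1 by rewrite ltr0n.
(* As f + M lies between 0 and 2 M, the integer part of [h] is always below L, so L levels
   suffice. *)
set L := (Num.truncn (2 * M * N1)).+1.
pose h y := (f y + M) * N1.
have h_ge0 y : 0 <= h y.
  have := fM y; rewrite ler_norml => /andP[My _].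
  by rewrite mulr_ge0 ?(ltW N1_gt0)// -lerBlDr sub0r.
have h_lt y : (Num.truncn (h y) < L)%N.
  rewrite ltnS; apply: le_truncn; rewrite ler_pM2r// [leRHS]mulr_natl mulr2n lerD2r.
  by rewrite (le_trans (ler_norm _)).
pose A (j : nat) := h @^-1` `[j%:R, j.+1%:R[%classic.
have mh : measurable_fun setT h.
  by apply: measurable_funM => //; exact: measurable_funD.
have mA j : measurable (A j) by rewrite -[A j]setTI; exact: mh.
pose a (j : nat) : R := j%:R / N1 - M.
pose fN y := \sum_(j < L) a j * \1_(A j) y.
have fNE y : fN y = a (Num.truncn (h y)).
  rewrite /fN (bigD1 (Ordinal (h_lt y)))//= big1 ?addr0.
    by rewrite indicE mem_set ?mulr1// /A /= in_itv /= truncn_itv.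
  move=> j jy; rewrite indicE memNset ?mulr0// /A /= in_itv /= => /truncn_def hj.
  by move/eqP: jy; apply; apply/val_inj; rewrite /= hj.
have mfN : measurable_fun setT fN.
  apply: measurable_sum => j; apply: measurable_funM => //; exact: mind.
have errfN y : `|f y - fN y| <= N1^-1.
  rewrite fNE /a; have /andP[h1 h2] := truncn_itv (h_ge0 y).
  have -> : f y - ((Num.truncn (h y))%:R / N1 - M) = (h y - (Num.truncn (h y))%:R) / N1.
    by rewrite /h; field; rewrite gt_eqF.
  rewrite normrM ger0_norm ?subr_ge0// gtr0_norm ?invr_gt0// ler_piMl//.
    by rewrite invr_ge0 ltW.
  by rewrite lerBlDr addrC natr1 ltW.
have fNb y : `|fN y| <= M + N1^-1.
  have -> : fN y = f y - (f y - fN y) by ring.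
  by rewrite (le_trans (ler_normB _ _))// lerD.
have simple : \int[P]_w (G w * fN (X w)) = c * \int[P]_w fN (X w).
  under eq_Rintegral do rewrite mulr_sumr.
  rewrite !Rintegral_sum; last 2 first.
  - move=> j; apply: integrable_realZl; exact: intg (mind _ (mA j)) (ind1 _).
  - move=> j; under eq_fun do rewrite mulrCA; apply: integrable_realZl.
    exact: intGg (mind _ (mA j)) (ind1 _).
  rewrite mulr_sumr; apply: eq_bigr => j _.
  under eq_Rintegral do rewrite mulrCA.
  rewrite (RintegralZl (f := fun w => G w * \1_(A j) (X w)))//; last first.
    exact: intGg (mind _ (mA j)) (ind1 _).
  rewrite (RintegralZl (f := fun w => \1_(A j) (X w)))//; last first.
    exact: intg (mind _ (mA j)) (ind1 _).
  by rewrite indE// mulrCA.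
have mD : measurable_fun setT (fun y => f y - fN y) by exact: measurable_funB.
(* The identity is exact for [fN], so only the rounding error f - fN contributes. *)
have -> : \int[P]_w (G w * f (X w)) - c * \int[P]_w f (X w) =
    \int[P]_w (G w * (f (X w) - fN (X w))) - c * \int[P]_w (f (X w) - fN (X w)).
  rewrite [X in _ = X - _](_ : _ = \int[P]_w (G w * f (X w)) -
      \int[P]_w (G w * fN (X w))); last first.
    rewrite -RintegralB//; [|exact: intGg fM|exact: intGg fNb].
    by apply: eq_Rintegral => w _; rewrite mulrBr.
  rewrite (RintegralB (f1 := fun w => f (X w)))//; last 2 first.
  - exact: intg fM.
  - exact: intg fNb.
  by rewrite simple; ring.
rewrite (le_trans (ler_normB _ _))// mulrDl normrM lerD//.
- apply: le_trans (le_normr_Rintegral measurableT (intGg _ _ mD errfN)) _.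
  rewrite -[leRHS](Rintegral_prob_cst P); apply: le_Rintegral => //.
  + apply: (@bounded_integrable _ _ _ P _ (K * N1^-1)).
      apply: measurableT_comp => //; apply: measurable_funM => //.
      exact: (measurableT_comp mD mX).
    by move=> w; rewrite normr_id normrM ler_pM.
  + exact: integrable_real_cst.
  + by move=> w _; rewrite normrM ler_pM.
- rewrite ler_wpM2l//.
  apply: le_trans (le_normr_Rintegral measurableT (intg _ _ mD errfN)) _.
  rewrite -[leRHS](Rintegral_prob_cst P); apply: le_Rintegral => //.
  + apply: (@bounded_integrable _ _ _ P _ (N1^-1)).
      apply: measurableT_comp => //; exact: (measurableT_comp mD mX).
    by move=> w; rewrite normr_id.
  + exact: integrable_real_cst.
Qed.

(** The product of the indicators is the indicator of the intersection, to which
    [mutually_independent] applies with the index set {0, ..., n - 1}. *)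
Lemma Rintegral_prod_indic (e : nat -> {RV P >-> R}) (n : nat) (A : nat -> set R) :
    mutually_independent e -> (forall i, measurable (A i)) ->
  \int[P]_w (\prod_(i < n) \1_(A i) (e i w)) =
  \prod_(i < n) \int[P]_w \1_(A i) (e i w).
Proof.
move=> indep mA; pose J : {fset nat} := [fset i in iota 0 n]%fset.
have perm_J : perm_eq J (index_iota 0 n).
  rewrite /index_iota subn0; apply: uniq_perm; rewrite ?fset_uniq ?iota_uniq//.
  by move=> i; rewrite in_fset.
have mpre i : measurable (e i @^-1` A i) by exact: measurable_funPTI.
have -> : \prod_(i < n) \int[P]_w \1_(A i) (e i w) =
    fine (\prod_(i <- J) P (e i @^-1` A i))%E.
  rewrite (perm_big _ perm_J) big_mkord.
  rewrite (eq_bigr (fun i : 'I_n => (fine (P (e i @^-1` A i)))%:E)); last first.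
    by move=> i _; rewrite fineK ?fin_num_measure.
  rewrite prodEFin /=; apply: eq_bigr => i _.
  by rewrite -Rintegral_prob_indic.
rewrite -indep// -Rintegral_prob_indic; last first.
  by apply: bigcap_measurableType => i _; exact: mpre.
apply: eq_Rintegral => w _; rewrite [in RHS]indicE.
have [wJ|wJ] := boolP (w \in _).
- rewrite big1// => i _; rewrite indicE mem_set//.
  move/set_mem : wJ => /(_ i); apply => /=; rewrite (perm_mem perm_J) mem_index_iota.
  exact: ltn_ord.
- have [i Ai] : exists i : 'I_n, ~ A i (e i w).
    apply: contra_notP (negP wJ) => /forallNP AJ; apply/mem_set => i /=.
    rewrite (perm_mem perm_J) mem_index_iota /= => i_n.
    exact: (contrapT (AJ (Ordinal i_n))).
  by rewrite (bigD1 i)//= indicE memNset// mul0r.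
Qed.

(* The indicators of the independence hypothesis are replaced one at a time   *)
(* by general bounded functions.                                              *)
Lemma Rintegral_prod_indep (e : nat -> {RV P >-> R}) (n : nat) (f : nat -> R -> R)
    (M : R) :
    mutually_independent e -> (forall i, measurable_fun setT (f i)) ->
    (forall i y, `|f i y| <= M) ->
  \int[P]_w (\prod_(i < n) f i (e i w)) = \prod_(i < n) \int[P]_w f i (e i w).
Proof.
move=> indep mf fM.
(* The first k factors are arbitrary bounded functions, the others still indicators; indices from n
   on are padded with the indicator of the whole line. *)
suff replace k : (k <= n)%N -> forall g : nat -> R -> R,
    (forall i, measurable_fun setT (g i)) ->
    (forall i, exists b : R, forall y, `|g i y| <= b) ->
    (forall i, (k <= i)%N -> exists2 A, measurable A & g i = \1_A) ->
    \int[P]_w (\prod_(i < n) g i (e i w)) = \prod_(i < n) \int[P]_w g i (e i w).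
  pose g i := if (i < n)%N then f i else \1_setT.
  have gf (i : 'I_n) : g i = f i by rewrite /g ltn_ord.
  have := replace n (leqnn n) g.
  rewrite (eq_bigr (fun i : 'I_n => \int[P]_w f i (e i w))); last first.
    by move=> i _; apply: eq_Rintegral => w _; rewrite gf.
  rewrite (eq_Rintegral P (g := fun w => \prod_(i < n) f i (e i w))); last first.
    by move=> w _; apply: eq_bigr => i _; rewrite gf.
  apply.
  - by move=> i; rewrite /g; case: ifP => // _; exact: measurable_indic.
  - move=> i; exists (Num.max M 1) => y; rewrite le_max /g; case: ifP => _.
      by rewrite fM.
    by rewrite indicT normr1 lexx orbT.
  - by move=> i ni; exists setT => //; rewrite /g ltnNge ni.
elim: k => [_|k IH k_n] g mg gb gind.
  have /choice[A mA] : forall i, exists A, measurable A /\ g i = \1_A.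
    by move=> i; have [A mA gA] := gind i isT; exists A.
  under eq_Rintegral do under eq_bigr do rewrite (mA _).2.
  under [RHS]eq_bigr do rewrite (mA _).2.
  by apply: Rintegral_prod_indic => // i; case: (mA i).
pose k' := Ordinal k_n.
have /choice[b gb'] := gb.
rewrite [RHS](bigD1 k')//= mulrC.
under eq_Rintegral do rewrite (bigD1 k')//= mulrC.
(* All factors but the k-th are frozen into G. The test on indicators that the lemma asks for is the
   induction hypothesis with the k-th function replaced by [\1_A]. *)
apply: (Rintegral_mul_comp (K := \prod_(i < n | i != k') b i) _ _ _ (mg k) (gb' k)).
- under eq_fun do rewrite big_mkcond.
  pose F (i : 'I_n) w := if i != k' then g i (e i w) else 1.
  have mF i : measurable_fun setT (F i).
    by rewrite /F; case: (i != k') => //; exact: (measurableT_comp (mg i)).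
  exact: (measurable_prod (fun i _ => mF i)).
- move=> w; rewrite normr_prod; apply: ler_prod => i _.
  by rewrite normr_ge0 gb'.
- move=> A mA.
  pose h i := if i == k then \1_A else g i.
  have hk : h k = \1_A by rewrite /h eqxx.
  have hg (i : 'I_n) : i != k' -> h i = g i by rewrite /h -val_eqE => /negPf /= ->.
  have := IH (ltnW k_n) h.
  rewrite [in RHS](bigD1 k')//= mulrC hk.
  rewrite (eq_bigr (fun i : 'I_n => \int[P]_w g i (e i w))); last first.
    by move=> i ik; rewrite hg.
  rewrite (eq_Rintegral P
    (g := fun w => \prod_(i < n | i != k') g i (e i w) * \1_A (e k w))).
    apply.
    + by move=> i; rewrite /h; case: ifP => // _; exact: measurable_indic.
    + move=> i; rewrite /h; case: ifP => // _; exists 1 => y.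
      by rewrite indicE; case: (_ \in _); rewrite /= ?normr0 ?normr1.
    + move=> i ki; rewrite /h; case: eqP => [_|/eqP ik]; first by exists A.
      by apply: gind; rewrite ltn_neqAle eq_sym ik.
  move=> w _; rewrite (bigD1 k')//= mulrC hk; congr (_ * _).
  by apply: eq_bigr => i ik; rewrite hg.
Qed.

(** Chernoff's method. It matters that q depends only on c and eps, so that the functions f may
    change with n. *)
Lemma bounded_sum_tail (e : nat -> {RV P >-> R}) (c eps : R) :
    mutually_independent e -> 0 < c -> 0 < eps ->
  exists2 q : R, 0 <= q < 1 & forall (n : nat) (f : nat -> R -> R),
    (forall i, measurable_fun setT (f i)) -> (forall i y, `|f i y| <= c) ->
    (P [set w | (eps * n%:R <=
                 \sum_(i < n) (f i (e i w) - \int[P]_v f i (e i v)))%R] <=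
     (q ^+ n)%:E)%E.
Proof.
move=> indep c_gt0 eps_gt0.
(* The two terms of D give the two properties of s = eps / D: 2 c s <= 1/2, so that the quadratic
   bound on exp applies to the centred terms, and 16 c^2 s <= eps, so that each moment 1 + 8 (s c)^2
   is at most exp(s eps / 2). *)
set D := 16 * c ^+ 2 + 4 * c * eps.
have D_gt0 : 0 < D by rewrite addr_gt0// ?mulr_gt0// exprn_gt0.
set s := eps / D; have s_gt0 : 0 < s by exact: divr_gt0.
have sD : s * D = eps by rewrite /s mulfVK// gt_eqF.
have s2c : s * (2 * c) <= 1 / 2.
  have : 4 * c * (s * D) = 4 * c * eps by rewrite sD.
  rewrite -(ler_pM2r D_gt0) /D => h; have : 0 < c ^+ 2 by rewrite exprn_gt0.
  lra.
have s16c : 16 * c ^+ 2 * s <= eps.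
  rewrite -[leRHS]sD mulrC ler_pM2l// /D lerDl.
  by rewrite !mulr_ge0 ?(ltW eps_gt0) ?(ltW c_gt0).
exists (expR (- (s * eps / 2))).
  by rewrite expR_ge0 expR_lt1 oppr_lt0 divr_gt0// mulr_gt0.
move=> n f mf fc; set m := fun i => \int[P]_v f i (e i v).
have mfe i : measurable_fun setT (fun w => f i (e i w)).
  exact: (measurableT_comp (mf i)).
have intf i : integrable_real (fun w => f i (e i w)).
  exact: (@bounded_integrable _ _ _ P _ c).
have mc i : `|m i| <= c.
  apply: le_trans (le_normr_Rintegral measurableT (intf i)) _.
  rewrite -[leRHS](Rintegral_prob_cst P); apply: le_Rintegral => //.
  - apply: (@bounded_integrable _ _ _ P _ c); first exact: measurableT_comp.
    by move=> w; rewrite normr_id.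
  - exact: integrable_real_cst.
pose h i y := expR (s * (f i y - m i)).
have sfm i y : `|s * (f i y - m i)| <= 1 / 2.
  rewrite normrM gtr0_norm// (le_trans _ s2c)// ler_pM2l//.
  by rewrite (le_trans (ler_normB _ _))// [leRHS]mulr_natl mulr2n lerD.
have mh i : measurable_fun setT (h i).
  apply: measurableT_comp; first exact: measurable_expR.
  by apply: measurable_funM => //; exact: measurable_funB.
have hb i y : `|h i y| <= expR (1 / 2).
  by rewrite ger0_norm ?expR_ge0// ler_expR (le_trans (ler_norm _)).
have mhe i : measurable_fun setT (fun w => h i (e i w)).
  exact: (measurableT_comp (mh i)).
have inth i : integrable_real (fun w => h i (e i w)).
  exact: (@bounded_integrable _ _ _ P _ (expR (1 / 2))).
pose F w := expR (- (s * eps)) ^+ n * \prod_(i < n) h i (e i w).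
have intprod : integrable_real (fun w => \prod_(i < n) h i (e i w)).
  apply: (@bounded_integrable _ _ _ P _ (\prod_(i < n) expR (1 / 2))).
    exact: (measurable_prod (fun (i : 'I_n) _ => mhe i)).
  by move=> w; rewrite normr_prod ler_prod// => i _; rewrite normr_ge0 hb.
have intF : integrable_real F by exact: integrable_realZl.
apply: (le_trans (probability_le_Rintegral _ intF _)).
- have mS : measurable_fun setT (fun w => \sum_(i < n) (f i (e i w) - m i)).
    by apply: measurable_sum => i; exact: measurable_funB.
  rewrite [X in measurable X](_ : _ =
      (fun w => \sum_(i < n) (f i (e i w) - m i)) @^-1` `[eps * n%:R, +oo[%classic).
    by rewrite -[X in measurable X]setTI; exact: mS.
  by apply/seteqP; split => w /=; rewrite in_itv /= andbT.
- move=> w; have F_ge0 : 0 <= F w.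
    rewrite mulr_ge0 ?exprn_ge0 ?expR_ge0// prodr_ge0// => i _.
    exact: expR_ge0.
  rewrite indicE; have [/set_mem wA|_] := boolP (w \in _); last exact: F_ge0.
  have -> : F w =
      expR (s * (\sum_(i < n) (f i (e i w) - m i) - eps * n%:R)).
    rewrite /F -expRM_natr /h -expR_sum -mulr_sumr -expRD; congr expR; ring.
  by rewrite -[leLHS]expR0 ler_expR mulr_ge0 ?(ltW s_gt0)// subr_ge0.
rewrite lee_fin /F RintegralZl// (Rintegral_prod_indep n indep mh hb).
have meanh i : \int[P]_w h i (e i w) <= expR (s * eps / 2).
  apply: (@le_trans _ _ (1 + 8 * (s * c) ^+ 2)).
    apply: (@le_trans _ _ (\int[P]_w (1 + 2 * (s * (2 * c)) ^+ 2
        + s * (f i (e i w) - m i)))).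
      apply: le_Rintegral => //.
        apply: integrable_realD; first exact: integrable_real_cst.
        apply: integrable_realZl; apply: integrable_realB => //.
        exact: integrable_real_cst.
      move=> w _; apply: le_trans (expR_le_quadratic (sfm i _)) _.
      rewrite addrAC lerD2r lerD2l ler_pM2l//.
      rewrite -real_normK ?num_real// lerXn2r ?nnegrE//.
        by rewrite pmulr_rge0// pmulr_rge0// ltW.
      rewrite normrM gtr0_norm// ler_pM2l//.
      by rewrite (le_trans (ler_normB _ _))// [leRHS]mulr_natl mulr2n lerD.
    rewrite RintegralD//; last 2 first.
    - exact: integrable_real_cst.
    - apply: integrable_realZl; apply: integrable_realB => //.
      exact: integrable_real_cst.
    rewrite RintegralZl//; last first.
      by apply: integrable_realB => //; exact: integrable_real_cst.
    rewrite RintegralB//; last exact: integrable_real_cst.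
    rewrite !Rintegral_prob_cst subrr mulr0 addr0.
    by rewrite le_eqVlt; apply/orP; left; apply/eqP; ring.
  apply: le_trans (expR_ge1Dx _) _; rewrite ler_expR.
  have -> : 8 * (s * c) ^+ 2 = s * (16 * c ^+ 2 * s) / 2 by field.
  by rewrite ler_pM2r ?invr_gt0// ler_pM2l.
apply: (@le_trans _ _ (expR (- (s * eps)) ^+ n * \prod_(i < n) expR (s * eps / 2))).
  rewrite ler_wpM2l ?exprn_ge0 ?expR_ge0//; apply: ler_prod => i _.
  by rewrite meanh andbT Rintegral_ge0// => w _; exact: expR_ge0.
rewrite prodr_const card_ord -exprMn -expRD.
suff -> : - (s * eps) + s * eps / 2 = - (s * eps / 2) by [].
by field.
Qed.

(** Independence kills the cross terms, and a variance is at most the second moment. *)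
Lemma indep_sum_sqr_le (e : nat -> {RV P >-> R}) (n : nat) (g : R -> R) (M : R) :
    mutually_independent e -> measurable_fun setT g -> (forall y, `|g y| <= M) ->
  \int[P]_w (\sum_(i < n) (g (e i w) - \int[P]_v g (e i v))) ^+ 2 <=
  \sum_(i < n) \int[P]_w g (e i w) ^+ 2.
Proof.
move=> indep mg gM; set m := fun i => \int[P]_v g (e i v).
have M_ge0 : 0 <= M by rewrite (le_trans _ (gM 0)).
have intg i : integrable_real (fun w => g (e i w)).
  apply: (@bounded_integrable _ _ _ P _ M) => //.
  exact: (measurableT_comp mg).
pose c i y := g y - m i.
have mc i : measurable_fun setT (c i) by exact: measurable_funB.
have cb i y : `|c i y| <= M + `|m i|.
  by rewrite (le_trans (ler_normB _ _))// lerD2r.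
have intcc i j : integrable_real (fun w => c i (e i w) * c j (e j w)).
  apply: (@bounded_integrable _ _ _ P _ ((M + `|m i|) * (M + `|m j|))).
    by apply: measurable_funM; [exact: (measurableT_comp (mc i))|
      exact: (measurableT_comp (mc j))].
  by move=> w; rewrite normrM ler_pM.
have c0 i : \int[P]_w c i (e i w) = 0.
  rewrite RintegralB//; last exact: integrable_real_cst.
  by rewrite Rintegral_prob_cst subrr.
have uncorrelated (i j : 'I_n) : i != j ->
    \int[P]_w (c i (e i w) * c j (e j w)) = 0.
  (* Padding with the constant 1 turns the product of two factors into one over all indices. *)
  move=> ij; pose f (l : nat) :=
    if l == i :> nat then c i else if l == j :> nat then c j else \1_setT.
  have ji : (j : nat) == i = false by rewrite val_eqE eq_sym; exact/negbTE.
  have mf l : measurable_fun setT (f l).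
    rewrite /f; case: (l == i :> nat); first exact: mc.
    case: (l == j :> nat); first exact: mc.
    exact: measurable_indic.
  have := @Rintegral_prod_indep e n f (1 + M + `|m i| + `|m j|) indep mf.
  rewrite (eq_Rintegral P (g := fun w => c i (e i w) * c j (e j w))); last first.
    move=> w _; rewrite (bigD1 i)//= (bigD1 j)/= 1?eq_sym// big1 ?mulr1.
      by rewrite /f eqxx ji eqxx.
    move=> l /andP[/negPf li /negPf lj]; rewrite /f !val_eqE li lj indicT.
    by [].
  move=> ->.
    by rewrite (bigD1 i)//= /f eqxx c0 mul0r.
  move=> l y; rewrite /f; case: (_ == _).
    apply: le_trans (cb i y) _; have := normr_ge0 (m j); lra.
  case: (_ == _).
    apply: le_trans (cb j y) _; have := normr_ge0 (m i); lra.
  rewrite indicT normr1; have := normr_ge0 (m i); have := normr_ge0 (m j); lra.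
under eq_Rintegral do rewrite expr2 big_distrlr /=.
rewrite Rintegral_sum; last by move=> i; apply: integrable_real_sum => j; exact: intcc.
apply: ler_sum => i _; rewrite Rintegral_sum; last by move=> j; exact: intcc.
rewrite (bigD1 i)//= big1 ?addr0; last first.
  by move=> j ji; rewrite uncorrelated// eq_sym.
have intg2 : integrable_real (fun w => g (e i w) ^+ 2).
  apply: (@bounded_integrable _ _ _ P _ (M ^+ 2)).
    by apply: measurable_funX; exact: (measurableT_comp mg).
  by move=> w; rewrite normrX lerXn2r// ?nnegrE.
rewrite (eq_Rintegral P (g := fun w =>
    g (e i w) ^+ 2 + (- m i * (g (e i w) + c i (e i w))))); last first.
  by move=> w _; rewrite /c -/(m i); ring.
have intgc : integrable_real (fun w => g (e i w) + c i (e i w)).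
  apply: integrable_realD => //; apply: integrable_realB => //.
  exact: integrable_real_cst.
rewrite RintegralD//; last exact: integrable_realZl.
rewrite RintegralZl// RintegralD//; last first.
  by apply: integrable_realB => //; exact: integrable_real_cst.
by rewrite c0 addr0 mulNr gerDl oppr_le0 -expr2 sqr_ge0.
Qed.

(* Truncating at 2^k and applying Chebyshev's inequality to the first 2^k      *)
(* terms gives summable probabilities; a general n is compared with the next   *)
(* power of two, which is why the constant is 4 and not 1.                     *)
Lemma iid_sum_le (e : nat -> {RV P >-> R}) (f : R -> R) (b : R) :
    mutually_independent e -> identically_distributed e ->
    measurable_fun setT f -> (forall y, 0 <= f y) ->
    integrable_real (fun w => f (e 0%N w)) -> \int[P]_w f (e 0%N w) <= b -> 0 < b ->
  {ae P, forall w, \forall n \near \oo, \sum_(i < n) f (e i w) <= 4 * b * n%:R}.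
Proof.
move=> indep ident mf f_ge0 intf fb b_gt0.
pose W (k : nat) y := Num.min (f y) (2 ^+ k).
have p_gt0 k : 0 < 2 ^+ k :> R by rewrite exprn_gt0.
have W_ge0 k y : 0 <= W k y by rewrite le_min f_ge0 ltW.
have mW k : measurable_fun setT (W k) by exact: measurable_minr.
have Wb k y : `|W k y| <= 2 ^+ k by rewrite ger0_norm// ge_min lexx orbT.
have mWe k i : measurable_fun setT (fun w => W k (e i w)).
  exact: (measurableT_comp (mW k)).
have mW2 k : measurable_fun setT (fun y => W k y ^+ 2) by exact: measurable_funX.
have W2b k y : `|W k y ^+ 2| <= (2 ^+ k) ^+ 2.
  by rewrite normrX lerXn2r ?nnegrE// ltW.
have intW k i : integrable_real (fun w => W k (e i w)).
  exact: (@bounded_integrable _ _ _ P _ (2 ^+ k)).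
have intW2 k i : integrable_real (fun w => W k (e i w) ^+ 2).
  apply: (@bounded_integrable _ _ _ P _ ((2 ^+ k) ^+ 2)) => //.
  exact: measurable_funX.
have idem i := ident i 0%N.
have intfi i : integrable_real (fun w => f (e i w)).
  exact: (integrable_ident_distrib (ident 0%N i) mf intf).
pose m k i := \int[P]_v W k (e i v).
have mb k i : m k i <= b.
  apply: le_trans fb; rewrite -(Rintegral_ident_distrib (idem i) mf (intfi i) intf).
  by apply: le_Rintegral => // w _; rewrite ge_min lexx.
pose v k := \int[P]_w W k (e 0%N w) ^+ 2.
have vE k i : \int[P]_w W k (e i w) ^+ 2 = v k.
  exact: (Rintegral_ident_distrib (idem i) (mW2 k) (intW2 k i) (intW2 k 0%N)).
pose S k w := \sum_(i < 2 ^ k) (W k (e i w) - m k i).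
(* [F k w >= 1] whenever the truncated sum deviates by b 2^k or a truncation   *)
(* is effective.                                                               *)
pose F (k : nat) w := (b * 2 ^+ k) ^- 2 * S k w ^+ 2
   + (2 ^+ k) ^- 2 * \sum_(i < 2 ^ k) W k (e i w) ^+ 2.
have mS k : measurable_fun setT (S k).
  by apply: measurable_sum => i; exact: measurable_funB.
have intS2 k : integrable_real (fun w => S k w ^+ 2).
  apply: (@bounded_integrable _ _ _ P _ ((\sum_(i < 2 ^ k) (2 ^+ k + `|m k i|)) ^+ 2)).
    exact: measurable_funX.
  have S_ge0 : 0 <= \sum_(i < 2 ^ k) (2 ^+ k + `|m k i|).
    by apply: sumr_ge0 => i _; rewrite addr_ge0// ltW.
  move=> w; rewrite normrX lerXn2r ?nnegrE//.
  apply: le_trans (ler_norm_sum _ _ _) _; apply: ler_sum => i _.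
  by rewrite (le_trans (ler_normB _ _))// lerD2r.
have mF k : measurable_fun setT (F k).
  apply: measurable_funD; apply: measurable_funM => //; first exact: measurable_funX.
  by apply: measurable_sum => i; exact: measurable_funX.
have intsum k : integrable_real (fun w => \sum_(i < 2 ^ k) W k (e i w) ^+ 2).
  by apply: integrable_real_sum => i; exact: intW2.
have intF k : integrable_real (F k).
  by apply: integrable_realD; exact: integrable_realZl.
have F_ge0 k w : 0 <= F k w.
  apply: addr_ge0; apply: mulr_ge0; rewrite ?invr_ge0 ?sqr_ge0//.
  by apply: sumr_ge0 => i _; rewrite sqr_ge0.
(* Both parts of [F] reduce to 2^k second moments divided by a multiple of 4^k. *)
have EF k : \int[P]_w F k w <= (b ^- 2 + 1) * (v k / 2 ^+ k).
  rewrite RintegralD//; [|exact: integrable_realZl|exact: integrable_realZl].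
  rewrite !RintegralZl//.
  have sumv : \sum_(i < 2 ^ k) \int[P]_w W k (e i w) ^+ 2 = 2 ^+ k * v k.
    rewrite (eq_bigr (fun=> v k)); last by move=> i _; exact: vE.
    by rewrite sumr_const card_ord -[LHS]mulr_natl natrX.
  rewrite Rintegral_sum; last by move=> i; exact: intW2.
  rewrite sumv.
  have -> : (b ^- 2 + 1) * (v k / 2 ^+ k) =
      (b * 2 ^+ k) ^- 2 * (2 ^+ k * v k) + (2 ^+ k) ^- 2 * (2 ^+ k * v k).
    by field; rewrite !gt_eqF.
  rewrite lerD2r ler_wpM2l ?invr_ge0 ?sqr_ge0//.
  rewrite -sumv; exact: (indep_sum_sqr_le _ indep (mW k) (Wb k)).
have sumF K : \sum_(k < K) \int[P]_w F k w <= (b ^- 2 + 1) * (4 * b).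
  have bb : 0 <= b ^- 2 + 1 by rewrite addr_ge0// invr_ge0 exprn_ge0// ltW.
  apply: (@le_trans _ _ (\sum_(k < K) (b ^- 2 + 1) * (v k / 2 ^+ k))).
    by apply: ler_sum => k _; exact: EF.
  rewrite -mulr_sumr ler_wpM2l//.
  rewrite (eq_bigr (fun k : 'I_K => \int[P]_w ((2 ^+ k)^-1 * W k (e 0%N w) ^+ 2)));
    last by move=> k _; rewrite RintegralZl// mulrC.
  rewrite -Rintegral_sum; last by move=> k; exact: integrable_realZl.
  apply: (@le_trans _ _ (\int[P]_w (4 * f (e 0%N w)))).
    apply: le_Rintegral => //.
    - by apply: integrable_real_sum => k; exact: integrable_realZl.
    - exact: integrable_realZl.
    - move=> w _; apply: le_trans (truncated_sqr_sum_le K (f_ge0 (e 0%N w))).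
      by apply: ler_sum => k _; rewrite mulrC.
  by rewrite RintegralZl// ler_pM2l.
pose B k := [set w | 1 <= F k w].
have mB k : measurable (B k).
  rewrite [B k](_ : _ = F k @^-1` `[1, +oo[%classic).
    by rewrite -[X in measurable X]setTI; exact: mF.
  by apply/seteqP; split => w /=; rewrite /B /= in_itv /= andbT.
have PB k : (P (B k) <= (\int[P]_w F k w)%:E)%E.
  apply: probability_le_Rintegral => // w; rewrite indicE.
  by have [/set_mem|_] := boolP (w \in _); [|rewrite F_ge0].
have sumB K : (\sum_(k < K) P (B k) <= ((b ^- 2 + 1) * (4 * b))%:E)%E.
  apply: (@le_trans _ _ (\sum_(k < K) (\int[P]_w F k w)%:E)%E).
    by apply: lee_sum => k _; exact: PB.
  by rewrite sumEFin lee_fin.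
have := borel_cantelli_bounded mB sumB; apply: filterS => w [k0 _ k0B].
exists (2 ^ k0)%N => // n /= k0n.
have n_gt0 : (0 < n)%N by rewrite (leq_trans _ k0n)// expn_gt0.
(* This is the k with n < 2^k <= 2 n. *)
pose k := (trunc_log 2 n).+1.
have nk : (n < 2 ^ k)%N by exact: trunc_log_ltn.
have kn : (2 ^ k <= 2 * n)%N by rewrite expnS leq_mul2l /= trunc_logP.
have k0k : (k0 <= k)%N.
  by rewrite -(leq_exp2l (m := 2))// (leq_trans k0n)// ltnW.
have := k0B k k0k; rewrite /B /= => /negP; rewrite -ltNge => Fk.
have t1_ge0 : 0 <= (b * 2 ^+ k) ^- 2 * S k w ^+ 2.
  by apply: mulr_ge0; rewrite ?invr_ge0 sqr_ge0.
have t2_ge0 : 0 <= \sum_(i < 2 ^ k) W k (e i w) ^+ 2.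
  by rewrite sumr_ge0// => i _; rewrite sqr_ge0.
have i2_ge0 : 0 <= (2 ^+ k) ^- 2 :> R by rewrite invr_ge0 exprn_ge0// ltW.
have Sk : S k w < b * 2 ^+ k.
  have bp : 0 < b * 2 ^+ k by rewrite mulr_gt0.
  rewrite ltNge; apply/negP => bS; move: Fk; rewrite ltNge => /negP; apply.
  rewrite /F -[leLHS]addr0 lerD ?mulr_ge0// mulrC ler_pdivlMr ?exprn_gt0// mul1r.
  by rewrite lerXn2r ?nnegrE ?(ltW bp)// (le_trans (ltW bp)).
have fW i : (i < 2 ^ k)%N -> f (e i w) = W k (e i w).
  move=> ik; rewrite /W; case: (leP (f (e i w)) (2 ^+ k)) => // fk.
  exfalso; move: Fk; rewrite ltNge => /negP; apply.
  rewrite /F -[leLHS]add0r lerD// mulrC ler_pdivlMr ?exprn_gt0// mul1r.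
  rewrite (bigD1 (Ordinal ik))//= -[leLHS]addr0 lerD//.
    by rewrite /W (min_idPr (ltW fk)).
  by rewrite sumr_ge0// => j _; rewrite sqr_ge0.
apply: (@le_trans _ _ (\sum_(i < 2 ^ k) f (e i w))).
  rewrite -!(big_mkord xpredT (fun i => f (e i w))).
  rewrite (big_cat_nat (n := n) (p := 2 ^ k))//=.
    by rewrite lerDl sumr_ge0.
  exact: ltnW.
rewrite (eq_bigr (fun i : 'I_(2 ^ k) => (W k (e i w) - m k i) + m k i)); last first.
  by move=> i _; rewrite fW// subrK.
rewrite big_split /=.
(* One b 2^k bounds the deviation and the other the mean; 2^k <= 2 n then yields 4 b n. *)
apply: (@le_trans _ _ (b * 2 ^+ k + b * 2 ^+ k)).
  apply: lerD; first exact: ltW.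
  apply: (@le_trans _ _ (\sum_(i < 2 ^ k) b)); first by apply: ler_sum => i _.
  by rewrite sumr_const card_ord -[leLHS]mulr_natr natrX.
have : (2 ^+ k : R) <= 2 * n%:R by rewrite -natrX -natrM ler_nat.
by move=> h; have := ler_wpM2l (ltW b_gt0) h; lra.
Qed.

(** The tails q^n are uniform over the rows of the array, hence summable, and Borel-Cantelli
    applies. *)
Lemma bounded_triangular_sum_le (e : nat -> {RV P >-> R}) (f : nat -> nat -> R -> R)
    (c eps : R) :
    mutually_independent e -> 0 < c -> 0 < eps ->
    (forall n i, measurable_fun setT (f n i)) ->
    (forall n i y, `|f n i y| <= c) ->
  {ae P, forall w, \forall n \near \oo, \sum_(i < n) f n i (e i w) <=
    \sum_(i < n) \int[P]_v f n i (e i v) + eps * n%:R}.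
Proof.
move=> indep c_gt0 eps_gt0 mf fc.
have [q /andP[q_ge0 q_lt1] tail] := bounded_sum_tail indep c_gt0 eps_gt0.
pose S n w := \sum_(i < n) (f n i (e i w) - \int[P]_v f n i (e i v)).
pose B n := [set w | eps * n%:R <= S n w].
have mB n : measurable (B n).
  rewrite [B n](_ : _ = S n @^-1` `[eps * n%:R, +oo[%classic); last first.
    by apply/seteqP; split => w /=; rewrite /B /= in_itv /= andbT.
  have mS : measurable_fun setT (S n).
    apply: measurable_sum => i; apply: measurable_funB => //.
    exact: (measurableT_comp (mf n i)).
  by rewrite -[X in measurable X]setTI; exact: mS.
have sumB K : (\sum_(n < K) P (B n) <= ((1 - q)^-1)%:E)%E.
  apply: (@le_trans _ _ (\sum_(n < K) (q ^+ n)%:E)%E).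
    by apply: lee_sum => n _; exact: tail.
  rewrite sumEFin lee_fin -[leRHS]mul1r ler_pdivlMr ?subr_gt0//.
  have := subrX1 q K; have : 0 <= q ^+ K by rewrite exprn_ge0.
  lra.
have := borel_cantelli_bounded mB sumB; apply: filterS => w.
apply: filterS => n /negP; rewrite /B /= -ltNge /S sumrB => /ltW.
by rewrite lerBlDl.
Qed.

(** Dominated convergence along integer levels: the truncation error vanishes pointwise and is at
    most |f|. *)
Lemma exists_truncation (f : T -> R) (eps : R) :
    integrable_real f -> 0 < eps ->
  exists2 M : R, 0 < M &
    \int[P]_w `|f w - Num.max (- M) (Num.min (f w) M)| <= eps.
Proof.
move=> intf eps_gt0.
have mf : measurable_fun setT f by apply/measurable_EFinP; case/integrableP : intf.
pose r (M : R) w := `|f w - Num.max (- M) (Num.min (f w) M)|.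
have mr M : measurable_fun setT (r M).
  apply: measurableT_comp => //; apply: measurable_funB => //.
  by apply: measurable_maxr => //; apply: measurable_minr.
have rf M w : 0 <= M -> r M w <= `|f w|.
  rewrite /r => M_ge0.
  have [h|h] := leP (f w) M; have [h'|h'] := leP (- M) _.
  - by rewrite subrr normr0.
  - by rewrite !ler0_norm; lra.
  - by rewrite !ger0_norm; lra.
  - by lra.
have r0 w : (r n%:R w)%:E @[n --> \oo] --> 0%E.
  apply: cvg_near_cst; near=> n; rewrite /r.
  have fn : `|f w| <= n%:R by near: n; exact: nbhs_infty_ger.
  move: fn; rewrite ler_norml => /andP[fn1 fn2].
  by rewrite (min_idPl fn2) (max_idPr fn1) subrr normr0.
have intnf : P.-integrable setT (fun w => `|(f w)%:E|)%E.
  exact: (integrable_abse intf).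
have [_ _] : [/\ P.-integrable setT (cst 0%E : T -> \bar R),
    (\int[P]_w `|(r n%:R w)%:E - 0| @[n --> \oo] --> 0)%E &
    (\int[P]_w (r n%:R w)%:E @[n --> \oo] --> \int[P]_w (cst 0 w))%E].
  apply: (@dominated_convergence _ _ _ P _ _ _ _ (fun w => `|(f w)%:E|%E)) => //.
  - by move=> n; apply/measurable_EFinP.
  - by apply: aeW => w _; exact: r0.
  - by apply: aeW => w n _; rewrite lee_fin normr_id rf.
rewrite integral0 => cvg_int.
have lt_eps := cvgr_lt _ (fine_cvg cvg_int) _ eps_gt0.
near \oo => n; exists n%:R; first by rewrite ltr0n; near: n; exact: nbhs_infty_gt.
by apply: ltW; near: n; apply: lt_eps.
Unshelve. all: by end_near. Qed.

(** The extended expectation is the difference of the integrals of the positive and negative parts.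
    If either were infinite the difference would be too, +oo - +oo being -oo by convention, so the
    value 0 forces both to be finite. *)
Lemma expectation_eq0_integrable (f : T -> R) :
  measurable_fun setT f -> ('E_P [f] = 0)%E -> integrable_real f /\ \int[P]_w f w = 0.
Proof.
move=> mf; rewrite unlock => Ef0; split; last by rewrite /Rintegral Ef0.
have mEf : measurable_fun setT (EFin \o f) by exact/measurable_EFinP.
apply/integrableP; split => //.
move: Ef0; rewrite integralE.
rewrite (_ : (fun x => `|(EFin \o f) x|)%E =
    ((EFin \o f)^\+ \+ (EFin \o f)^\-)%E); last first.
  by rewrite -fune_abse.
rewrite ge0_integralD//; last 2 first.
- exact: measurable_funepos.
- exact: measurable_funeneg.
have pos_ge0 : (0 <= \int[P]_x (EFin \o f)^\+ x)%E by exact: integral_ge0.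
have neg_ge0 : (0 <= \int[P]_x (EFin \o f)^\- x)%E by exact: integral_ge0.
move: pos_ge0 neg_ge0.
case: (\int[P]_x (EFin \o f)^\+ x)%E => [a| |] //.
all: case: (\int[P]_x (EFin \o f)^\- x)%E => [b| |] //.
by move=> _ _ _; rewrite ltry.
Qed.

End independence.

(** * M-estimation *)

(** A regular grid on the cube, with N + 1 points on each axis and step at most eta. *)
Lemma finite_net (R : realType) (p : nat) (delta eta : R) :
    0 < delta -> 0 < eta ->
  exists2 s : seq 'cV[R]_p,
    forall g, g \in s -> forall k, `|g k 0| <= delta &
    forall u : 'cV[R]_p, (forall k, `|u k 0| <= delta) ->
      exists2 g, g \in s & forall k, `|g k 0 - u k 0| <= eta.
Proof.
move=> delta_gt0 eta_gt0.
pose N := (Num.truncn (2 * delta / eta)).+1; pose st := 2 * delta / N%:R.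
have N_gt0 : 0 < N%:R :> R by rewrite ltr0n.
have st_gt0 : 0 < st by rewrite divr_gt0// mulr_gt0.
have st_eta : st <= eta.
  rewrite /st ler_pdivrMr// [leRHS]mulrC -ler_pdivrMr//.
  by apply/ltW; rewrite truncnS_gt.
have stN : st * N%:R = 2 * delta by rewrite /st mulfVK// gt_eqF.
pose a (j : nat) : R := - delta + st * j%:R.
have a_delta j : (j <= N)%N -> `|a j| <= delta.
  move=> jN; have : st * j%:R <= st * N%:R by rewrite ler_pM2l// ler_nat.
  have : 0 <= st * j%:R by rewrite mulr_ge0// ltW.
  by rewrite /a ler_norml stN => h1 h2; apply/andP; split; lra.
have near_a t : `|t| <= delta -> exists j : 'I_N.+1, `|a j - t| <= eta.
  rewrite ler_norml => /andP[t1 t2].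
  have z_ge0 : 0 <= (t + delta) / st by rewrite divr_ge0 ?(ltW st_gt0)//; lra.
  have /andP[j1 j2] := truncn_itv z_ge0.
  set j := Num.truncn _ in j1 j2.
  rewrite ler_pdivlMr// in j1; rewrite ltr_pdivrMr// in j2.
  have jN : (j < N.+1)%N.
    have : j%:R * st <= N%:R * st by rewrite [leRHS]mulrC stN; lra.
    by rewrite ler_pM2r// ler_nat.
  exists (Ordinal jN); rewrite /a /= distrC ler_norml.
  move: j1 j2; rewrite -natr1 mulrDl mul1r [st * _]mulrC => j1 j2.
  by apply/andP; split; lra.
exists [seq \col_k a (h k) | h : {ffun 'I_p -> 'I_N.+1}].
  by move=> g /mapP[h _ ->] k; rewrite mxE a_delta// -ltnS.
move=> u u_delta.
have /choice[h hE] : forall k, exists j : 'I_N.+1, `|a j - u k 0| <= eta.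
  by move=> k; exact: near_a.
exists (\col_k a ([ffun k => h k] k)).
  by apply/mapP; exists [ffun k => h k]; rewrite ?mem_enum.
by move=> k; rewrite mxE ffunE hE.
Qed.

(** In the average, with weights t and 1 - t, of the two subgradient inequalities at the
    intermediate point, the linear terms cancel. *)
Lemma subgradient_convex (R : realDomainType) (rho psi : R -> R) (y s t : R) :
    (forall a b, rho a + psi a * (b - a) <= rho b) -> 0 <= t <= 1 ->
  rho (y - t * s) <= t * rho (y - s) + (1 - t) * rho y.
Proof.
move=> sub /andP[t0 t1].
have h1 := ler_wpM2l t0 (sub (y - t * s) (y - s)).
have t1' : 0 <= 1 - t by rewrite subr_ge0.
have h2 := ler_wpM2l t1' (sub (y - t * s) y).
set z := y - t * s in h1 h2 *.
have e1 : t * (rho z + psi z * (y - s - z)) +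
    (1 - t) * (rho z + psi z * (y - z)) = rho z.
  by rewrite /z; ring.
lra.
Qed.

(** Monotonicity bounds the increments below, and a negative shift is a positive one seen from its
    other end. *)
Lemma nondecreasing_shift_le (R : realDomainType) (psi : R -> R)
    (Delta C z s : R) :
    nondecreasing_fun psi ->
    (forall h u : R, 0 < h < Delta -> psi (u + h) - psi u <= C) -> 0 <= C ->
  `|s| < Delta -> `|psi (z - s) - psi z| <= C.
Proof.
move=> nondec incr C_ge0.
have psi_le (z1 h : R) : 0 <= h -> h < Delta -> psi z1 <= psi (z1 + h) <= psi z1 + C.
  rewrite le_eqVlt => /predU1P[<- _|h_gt0 hD].
    by rewrite addr0 lexx lerDl.
  have := incr h z1; rewrite h_gt0 hD => /(_ isT) hh.
  by rewrite nondec ?lerDl ?(ltW h_gt0)//=; lra.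
have [s0|/ltW s0] := leP 0 s => sD.
  have /andP[h1 h2] := psi_le (z - s) s s0 (le_lt_trans (ler_norm _) sD).
  by rewrite subrK in h1 h2; rewrite ler_norml; apply/andP; split; lra.
have s0' : 0 <= - s by rewrite oppr_ge0.
have sD' : - s < Delta by rewrite (le_lt_trans (ler_norm _))// normrN.
have /andP[h1 h2] := psi_le z (- s) s0' sD'.
by rewrite ler_norml; apply/andP; split; lra.
Qed.

Lemma normr_nondecreasing_shift (R : realDomainType) (psi : R -> R)
    (Delta C z s : R) :
    nondecreasing_fun psi ->
    (forall h u : R, 0 < h < Delta -> psi (u + h) - psi u <= C) -> 0 <= C ->
  `|s| < Delta -> `|psi (z - s)| <= `|psi z| + C.
Proof.
move=> nondec incr C_ge0 sD.
have := nondecreasing_shift_le z nondec incr C_ge0 sD.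
by have := ler_normD (psi (z - s) - psi z) (psi z); rewrite subrK; lra.
Qed.

(* [phi] is the truncated score, [tau] and [L] bound the empirical means of     *)
(* the truncation error and of |psi|, and [r] is the fluctuation allowed for   *)
(* the truncated score on the net.                                             *)
Lemma M_estimate_close (R : realType) (p n : nat) (w : nat -> 'cV[R]_p)
    (y : nat -> R) (rho psi phi : R -> R) (net : seq 'cV[R]_p)
    (Delta C0 C1 K kappa delta eta r tau L : R) :
    (forall a b, rho a + psi a * (b - a) <= rho b) ->
    (forall h u : R, 0 < h < Delta -> psi (u + h) - psi u <= C0) ->
    (forall i k, (i < n)%N -> `|w i k 0| <= K) -> p%:R * K <= kappa -> 0 < kappa ->
    (forall v, \sum_(i < n) dotcv (w i) v ^+ 2 = n%:R * dotcv v v) ->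
    (0 < n)%N -> 0 < delta -> kappa * delta < Delta -> eta <= delta / 2 ->
    0 < C0 -> 0 < C1 ->
    (forall g, g \in net -> forall k, `|g k 0| <= delta) ->
    (forall u : 'cV[R]_p, (forall k, `|u k 0| <= delta) ->
      exists2 g, g \in net & forall k, `|g k 0 - u k 0| <= eta) ->
    (forall g, g \in net -> \sum_(i < n) (dotcv (w i) g / 2 *
      (psi (y i - dotcv (w i) g / 2) - psi (y i) + 2 * phi (y i))) <=
      - (C1 / 4) * \sum_(i < n) dotcv (w i) g ^+ 2 + r * n%:R) ->
    \sum_(i < n) `|psi (y i) - phi (y i)| <= tau * n%:R ->
    \sum_(i < n) `|psi (y i)| <= L * n%:R ->
    kappa * delta * tau + r + (L + C0) * (kappa * eta) < C1 * delta ^+ 2 / 16 ->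
  forall u : 'cV[R]_p,
    \sum_(i < n) rho (y i - dotcv (w i) u) <= \sum_(i < n) rho (y i) ->
  forall k, `|u k 0| < delta.
Proof.
move=> sub incr wK pK kappa_gt0 gramw n_gt0 delta_gt0 kdD eta_delta C0_gt0 C1_gt0
  net_delta net_eta Hnet Htail HL const u Fu k.
rewrite ltNge; apply/negP => uk.
have nondec := subgradient_nondecreasing sub.
have n_gt0' : 0 < n%:R :> R by rewrite ltr0n.
have [k1 k1max] : exists k1, forall k', `|u k' 0| <= `|u k1 0|.
  have [k1 _ k1max] := arg_maxP (fun k => `|u k 0|) (isT : xpredT k).
  by exists k1 => k'; exact: k1max.
have uk1 : delta <= `|u k1 0| by rewrite (le_trans uk).
have uk1_gt0 : 0 < `|u k1 0| by rewrite (lt_le_trans delta_gt0).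
(* Shrinking u towards 0 by t puts its largest coordinate exactly at delta; convexity keeps the
   objective there at most its value at 0. *)
pose t := delta / `|u k1 0|.
have t01 : 0 <= t <= 1.
  by rewrite divr_ge0 ?(ltW delta_gt0)// ler_pdivrMr// mul1r.
pose v := t *: u.
have vk k' : `|v k' 0| <= delta.
  rewrite mxE normrM ger0_norm; last by case/andP: t01.
  by rewrite /t mulrAC ler_pdivrMr// ler_pM2l.
have vk1 : `|v k1 0| = delta.
  rewrite mxE normrM ger0_norm; last by case/andP: t01.
  by rewrite mulfVK// gt_eqF.
have wle (i : nat) (z : 'cV[R]_p) a :
    (i < n)%N -> 0 <= a -> (forall k, `|z k 0| <= a) ->
    `|dotcv (w i) z| <= kappa * a.
  move=> i_n a_ge0 za; apply: le_trans (normr_dotcv_le (a := K) _ za) _.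
    by move=> k'; exact: wK.
  by rewrite ler_wpM2r.
have Fv : \sum_(i < n) rho (y i - dotcv (w i) v) <= \sum_(i < n) rho (y i).
  have /andP[t0 t1] := t01.
  apply: (@le_trans _ _ (t * \sum_(i < n) rho (y i - dotcv (w i) u) +
      (1 - t) * \sum_(i < n) rho (y i))).
    rewrite !mulr_sumr -big_split /=; apply: ler_sum => i _.
    by rewrite dotcvZr; exact: subgradient_convex.
  have := ler_wpM2l t0 Fu; lra.
have [g g_net gv] := net_eta v vk.
have gk := net_delta g g_net.
have eta_ge0 : 0 <= eta by rewrite (le_trans _ (gv k1)).
have tD (i : 'I_n) : `|dotcv (w i) g| <= kappa * delta by rewrite wle// ltW.
have gg : delta ^+ 2 / 4 <= dotcv g g.
  have gk1 : delta / 2 <= `|g k1 0|.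
    have := ler_normB (g k1 0) (g k1 0 - v k1 0).
    rewrite subKr vk1; have := gv k1; move: eta_delta; clear; lra.
  rewrite dotcvE (bigD1 k1)//= -[leLHS]addr0 lerD//.
    rewrite -expr2 -[g k1 0 ^+ 2]real_normK ?num_real//.
    have -> : delta ^+ 2 / 4 = (delta / 2) ^+ 2 by field.
    by rewrite lerXn2r// nnegrE divr_ge0// ltW.
  by rewrite sumr_ge0// => j _; rewrite -expr2 sqr_ge0.
have psiC z s := normr_nondecreasing_shift z nondec incr (ltW C0_gt0) (s := s).
(* Passing from v to the net point g costs little: the slopes at g are at most |psi (y i)| + C0, and
   g is within eta of v in every coordinate. *)
have upper : \sum_(i < n) rho (y i - dotcv (w i) g) - \sum_(i < n) rho (y i) <=
    (L + C0) * (kappa * eta) * n%:R.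
  apply: (@le_trans _ _ (\sum_(i < n) (`|psi (y i)| + C0) * (kappa * eta))).
    rewrite lerBlDr; apply: le_trans (lerD (lexx _) Fv); rewrite -big_split /=.
    apply: ler_sum => i _.
    have := sub (y i - dotcv (w i) g) (y i - dotcv (w i) v).
    rewrite (_ : y i - dotcv (w i) v - (y i - dotcv (w i) g) = dotcv (w i) (g - v));
      last by rewrite dotcvBr; ring.
    have : `|psi (y i - dotcv (w i) g) * dotcv (w i) (g - v)| <=
        (`|psi (y i)| + C0) * (kappa * eta).
      rewrite normrM ler_pM//; first by rewrite psiC// (le_lt_trans (tD i)).
      by apply: wle => // k'; rewrite [(g - v) k' 0]mxE [(- v) k' 0]mxE.
    by rewrite ler_norml => /andP[+ _]; clear; lra.
  rewrite -mulr_suml big_split /= sumr_const card_ord -[C0 *+ n]mulr_natr.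
  rewrite [leRHS]mulrAC ler_wpM2r ?mulr_ge0 ?(ltW kappa_gt0)//.
  by rewrite mulrDl lerD2r.
(* Two half-steps of the subgradient inequality. The lone 2 psi (y i) is replaced by 2 phi (y i), at
   a cost of at most kappa delta |psi - phi|; the difference of psi is kept since C0 bounds it. *)
have lower : - (\sum_(i < n) (dotcv (w i) g / 2 *
      (psi (y i - dotcv (w i) g / 2) - psi (y i) + 2 * phi (y i)))) -
      kappa * delta * (tau * n%:R) <=
    \sum_(i < n) rho (y i - dotcv (w i) g) - \sum_(i < n) rho (y i).
  apply: (@le_trans _ _ (- (\sum_(i < n) (dotcv (w i) g / 2 *
      (psi (y i - dotcv (w i) g / 2) - psi (y i) + 2 * phi (y i)))) -
      kappa * delta * \sum_(i < n) `|psi (y i) - phi (y i)|)).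
    by rewrite lerD2l lerN2 ler_wpM2l// mulr_ge0// ltW.
  rewrite mulr_sumr -opprD -big_split /= -sumrB -sumrN; apply: ler_sum => i _.
  set z := y i; set s := dotcv (w i) g.
  have h1 := sub (z - s / 2) (z - s); have h2 := sub z (z - s / 2).
  have e1 : z - s - (z - s / 2) = - (s / 2) by field.
  have e2 : z - s / 2 - z = - (s / 2) by ring.
  rewrite e1 in h1; rewrite e2 in h2.
  have : s * (psi z - phi z) <= kappa * delta * `|psi z - phi z|.
    apply: le_trans (ler_norm _) _; rewrite normrM ler_wpM2r//.
    exact: tD.
  by move: h1 h2; clear; lra.
(* As |g|^2 >= delta^2 / 4, the drift is at least n C1 delta^2 / 16, more than the errors allow. *)
have := Hnet g g_net; rewrite gramw.
have := ler_wpM2l (ltW n_gt0') gg.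
have C14 : 0 <= C1 / 4 by rewrite divr_ge0// ltW.
move=> /(ler_wpM2l C14) q1 q2.
have := ltr_pM2r n_gt0' (kappa * delta * tau + r + (L + C0) * (kappa * eta))
  (C1 * delta ^+ 2 / 16).
by rewrite const => q3; move: q1 q2 q3 upper lower; clear; lra.
Qed.

(** * Almost sure behaviour of the score, and consistency in normalised coordinates *)

Section robust_regression.
Context (R : realType) (d : measure_display) (T : measurableType d)
  (P : probability T R).

Local Notation integrable_real f := (P.-integrable setT (EFin \o f)).

Lemma integrable_psi_shift (X : {RV P >-> R}) (psi : R -> R) (Delta C u : R) :
    nondecreasing_fun psi ->
    (forall h u : R, 0 < h < Delta -> psi (u + h) - psi u <= C) -> 0 <= C ->
    integrable_real (fun w => psi (X w)) -> `|u| < Delta ->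
  integrable_real (fun w => psi (X w + u)).
Proof.
move=> nondec incr C_ge0 intpsi uD.
have mpsi : measurable_fun setT psi by exact: nondecreasing_measurable.
have intb : integrable_real (fun w => `|psi (X w)| + C).
  apply: integrable_realD; first exact: (integrable_norm intpsi).
  exact: integrable_real_cst.
apply: (le_integrable measurableT _ _ intb).
  apply/measurable_EFinP; apply: (measurableT_comp mpsi).
  exact: measurable_funD.
move=> w _ /=; rewrite lee_fin [leRHS]ger0_norm ?addr_ge0//.
rewrite -[u]opprK; apply: (normr_nondecreasing_shift _ nondec incr C_ge0).
by rewrite normrN.
Qed.

(** Since E psi(X) = 0 and psi is nondecreasing, E psi(X + u) has the sign of u, which removes the
    absolute value. *)
Lemma drift_psi_shift (X : {RV P >-> R}) (psi : R -> R) (Delta C0 C1 u : R) :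
    nondecreasing_fun psi ->
    (forall h u : R, 0 < h < Delta -> psi (u + h) - psi u <= C0) -> 0 <= C0 ->
    integrable_real (fun w => psi (X w)) -> \int[P]_w psi (X w) = 0 ->
    `|u| < Delta ->
    ((C1 * `|u|)%:E <= `| 'E_P [fun w => psi (X w + u)%R] |)%E ->
  C1 * u ^+ 2 <= u * \int[P]_w psi (X w + u).
Proof.
move=> nondec incr C0_ge0 intpsi psi0 uD.
have intu := integrable_psi_shift nondec incr C0_ge0 intpsi uD.
rewrite unlock -EFin_normr_Rintegral// lee_fin => C1u.
have -> : C1 * u ^+ 2 = `|u| * (C1 * `|u|).
  by rewrite -[u ^+ 2]real_normK ?num_real//; ring.
apply: (@le_trans _ _ (`|u| * `|\int[P]_w psi (X w + u)|)); first by rewrite ler_wpM2l.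
have [u_ge0|/ltW u_le0] := leP 0 u.
  rewrite !ger0_norm// -psi0; apply: le_Rintegral => // w _.
  by apply: nondec; rewrite lerDl.
rewrite (ler0_norm u_le0) ler0_norm ?mulrNN// -psi0; apply: le_Rintegral => // w _.
by apply: nondec; rewrite gerDl.
Qed.

(** The summands are bounded, by C0 for the increment of psi and M for its truncation, so the
    triangular law applies. For the means, the drift at -t/2 gives -C1 t^2 / 4, and E psi = 0 makes
    the mean of the truncated score at most epsM in absolute value. *)
Lemma score_sum_le (e : nat -> {RV P >-> R}) (psi : R -> R)
    (Delta C0 C1 A M epsM eps : R) (n1 : nat) (t : nat -> nat -> R) :
    mutually_independent e -> identically_distributed e ->
    nondecreasing_fun psi ->
    (forall h u : R, 0 < h < Delta -> psi (u + h) - psi u <= C0) -> 0 < C0 ->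
    integrable_real (fun w => psi (e 0%N w)) -> \int[P]_w psi (e 0%N w) = 0 ->
    (forall u : R, `|u| < Delta ->
      ((C1 * `|u|)%:E <= `| 'E_P [fun w => psi (e 0%N w + u)%R] |)%E) ->
    0 < M -> 0 < A -> A < Delta -> 0 < eps ->
    \int[P]_w `|psi (e 0%N w) - Num.max (- M) (Num.min (psi (e 0%N w)) M)| <= epsM ->
    (forall n i, (n1 <= n)%N -> (i < n)%N -> `|t n i| <= A) ->
  {ae P, forall w, \forall n \near \oo, \sum_(i < n) (t n i / 2 *
      (psi (e i w - t n i / 2) - psi (e i w) +
       2 * Num.max (- M) (Num.min (psi (e i w)) M))) <=
      - (C1 / 4) * \sum_(i < n) t n i ^+ 2 + (A * epsM + eps) * n%:R}.
Proof.
move=> indep ident nondec incr C0_gt0 intpsi psi0 drift M_gt0 A_gt0 AD eps_gt0.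
move=> truncM tA.
have mpsi : measurable_fun setT psi by exact: nondecreasing_measurable.
pose phi y := Num.max (- M) (Num.min (psi y) M).
have mphi : measurable_fun setT phi.
  by apply: measurable_maxr => //; exact: measurable_minr.
have phiM y : `|phi y| <= M.
  rewrite ler_norml /phi le_max lexx /= ge_max ge_min lexx orbT andbT.
  by rewrite (le_trans _ (ltW M_gt0))// oppr_le0 ltW.
(* The triangular law wants a bound at all indices, so t is set to 0 outside its range. *)
pose t' n i := if (n1 <= n)%N && (i < n)%N then t n i else 0.
have t'A n i : `|t' n i| <= A.
  by rewrite /t'; case: ifP => [/andP[]|_]; [exact: tA|rewrite normr0 ltW].
have half s : `|s| <= A -> `|s / 2| < Delta.
  move=> sA; rewrite normrM (ger0_norm (x := 2^-1))// ltr_pdivrMr//.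
  by have := normr_ge0 s; lra.
pose V s y := s / 2 * (psi (y - s / 2) - psi y + 2 * phi y).
have mV s : measurable_fun setT (V s).
  apply: measurable_funM => //; apply: measurable_funD.
    apply: measurable_funB => //; apply: (measurableT_comp mpsi).
    exact: measurable_funB.
  exact: measurable_funM.
have Vb s y : `|s| <= A -> `|V s y| <= A * (C0 + 2 * M).
  move=> sA; rewrite normrM ler_pM//.
    rewrite normrM (ger0_norm (x := 2^-1))// ler_pdivrMr//.
    by have := normr_ge0 s; lra.
  rewrite (le_trans (ler_normD _ _))// lerD//.
    apply: nondecreasing_shift_le nondec incr (ltW C0_gt0) _; exact: half.
  by rewrite normrM ger0_norm// ler_pM2l.
have intphi : integrable_real (fun w => phi (e 0%N w)).
  by apply: (@bounded_integrable _ _ _ P _ M) => //; exact: (measurableT_comp mphi).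
have EV s i : `|s| <= A ->
    \int[P]_w V s (e i w) <= - (C1 / 4) * s ^+ 2 + A * epsM.
  move=> sA.
  have intV j : integrable_real (fun w => V s (e j w)).
    apply: (@bounded_integrable _ _ _ P _ (A * (C0 + 2 * M))).
      exact: (measurableT_comp (mV s)).
    by move=> w; exact: Vb.
  rewrite (Rintegral_ident_distrib (ident i 0%N) (mV s) (intV i) (intV 0%N)).
  have shD : `|- (s / 2)| < Delta by rewrite normrN; exact: half.
  have ints : integrable_real (fun w => psi (e 0%N w - s / 2)).
    exact: (integrable_psi_shift nondec incr (ltW C0_gt0) intpsi shD).
  rewrite RintegralZl//; last first.
    apply: integrable_realD; last exact: integrable_realZl.
    exact: integrable_realB.
  rewrite RintegralD//; last 2 first.
  - exact: integrable_realB.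
  - exact: integrable_realZl.
  rewrite RintegralB// psi0 subr0 RintegralZl//.
  have h1 := drift_psi_shift nondec incr (ltW C0_gt0) intpsi psi0 shD (drift _ shD).
  have h2 : `|\int[P]_w phi (e 0%N w)| <= epsM.
    apply: le_trans truncM.
    rewrite -normrN -[X in `|X|]add0r -psi0 -RintegralB//.
    by apply: le_normr_Rintegral => //; exact: integrable_realB.
  have h3 : s * \int[P]_w phi (e 0%N w) <= A * epsM.
    by rewrite (le_trans (ler_norm _))// normrM ler_pM.
  move: h1; rewrite sqrrN expr_div_n.
  move: h3; clear; set I1 := \int[P]_w _; set I2 := \int[P]_w _; lra.
have := @bounded_triangular_sum_le _ _ _ P e (fun n i => V (t' n i)) _ _ indep _
  eps_gt0 (fun n i => mV _) (fun n i y => Vb _ y (t'A n i)).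
rewrite mulr_gt0 ?addr_gt0 ?mulr_gt0// => /(_ isT).
apply: filterS => w; apply: filterS2 (nbhs_infty_ge n1) => n n1n.
have t'E (i : 'I_n) : t' n i = t n i by rewrite /t' n1n ltn_ord.
rewrite (eq_bigr (fun i : 'I_n => V (t n i) (e i w))); last by move=> i _; rewrite t'E.
move=> /le_trans; apply.
rewrite mulrDl addrA lerD2r mulr_sumr.
apply: (@le_trans _ _ (\sum_(i < n) (- (C1 / 4) * t n i ^+ 2 + A * epsM))).
  by apply: ler_sum => i _; rewrite -t'E; exact: EV.
by rewrite big_split /= sumr_const card_ord -[(A * epsM) *+ n]mulr_natr.
Qed.

Lemma normalized_consistency (p : nat) (e : nat -> {RV P >-> R}) (rho psi : R -> R)
    (Delta C0 C1 K : R) (n1 : nat) (w : nat -> nat -> 'cV[R]_p) :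
    mutually_independent e -> identically_distributed e ->
    (forall a b, rho a + psi a * (b - a) <= rho b) ->
    0 < Delta -> 0 < C0 -> 0 < C1 ->
    (forall h u : R, 0 < h < Delta -> psi (u + h) - psi u <= C0) ->
    ('E_P [fun v => psi (e 0%N v)] = 0)%E ->
    (forall u : R, `|u| < Delta ->
      ((C1 * `|u|)%:E <= `| 'E_P [fun v => psi (e 0%N v + u)%R] |)%E) ->
    (forall n i k, (n1 <= n)%N -> (i < n)%N -> `|w n i k 0| <= K) ->
    (forall n v, (n1 <= n)%N -> \sum_(i < n) dotcv (w n i) v ^+ 2 = n%:R * dotcv v v) ->
  forall eps : R, 0 < eps ->
  {ae P, forall v, \forall n \near \oo, forall u : 'cV[R]_p,
    \sum_(i < n) rho (e i v - dotcv (w n i) u) <= \sum_(i < n) rho (e i v) ->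
    forall k, `|u k 0| < eps}.
Proof.
move=> indep ident sub Delta_gt0 C0_gt0 C1_gt0 incr Epsi drift wK gramw eps eps_gt0.
have nondec := subgradient_nondecreasing sub.
have mpsi : measurable_fun setT psi by exact: nondecreasing_measurable.
have [intpsi psi0] := expectation_eq0_integrable
  (measurableT_comp mpsi (measurable_funPT (e 0%N))) Epsi.
pose kappa := p%:R * `|K| + 1.
have kappa_gt0 : 0 < kappa by rewrite ltr_wpDl// mulr_ge0.
pose delta := Num.min eps (Delta / (2 * kappa)).
have delta_gt0 : 0 < delta by rewrite lt_min eps_gt0 divr_gt0// mulr_gt0.
have kdD : kappa * delta < Delta.
  apply: (@le_lt_trans _ _ (Delta / 2)); last by lra.
  have : delta <= Delta / (2 * kappa) by rewrite ge_min lexx orbT.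
  by rewrite ler_pdivlMr ?mulr_gt0// ler_pdivlMr//; lra.
pose c := C1 * delta ^+ 2 / 16.
have c_gt0 : 0 < c by rewrite divr_gt0// mulr_gt0// exprn_gt0.
(* Error budget against c: the truncation error takes 4 c/20, the score on the net c/20 + c/4, and
   the net approximation at most c/4, in all 3 c/4. *)
pose tau := c / (20 * kappa * delta).
have tau_gt0 : 0 < tau by rewrite divr_gt0// !mulr_gt0.
have tauE : kappa * delta * tau = c / 20 by rewrite /tau; field; rewrite !gt_eqF.
have [M M_gt0 truncM] := exists_truncation intpsi tau_gt0.
pose phi y := Num.max (- M) (Num.min (psi y) M).
pose L := 4 * (\int[P]_v `|psi (e 0%N v)| + 1).
have L_gt0 : 0 < L by rewrite mulr_gt0// ltr_wpDl// Rintegral_ge0.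
pose eta := Num.min (delta / 2) (c / (4 * kappa * (L + C0))).
have LC0 : 0 < L + C0 by rewrite addr_gt0.
have eta_gt0 : 0 < eta by rewrite lt_min !divr_gt0// !mulr_gt0.
have etaE : (L + C0) * (kappa * eta) <= c / 4.
  have : eta <= c / (4 * kappa * (L + C0)) by rewrite ge_min lexx orbT.
  by rewrite ler_pdivlMr ?mulr_gt0//; lra.
have [net net_delta net_eta] := finite_net p delta_gt0 eta_gt0.
have kd_gt0 : 0 < kappa * delta by rewrite mulr_gt0.
have ae_net : {ae P, forall v, \forall n \near \oo, forall g, g \in net ->
    \sum_(i < n) (dotcv (w n i) g / 2 *
      (psi (e i v - dotcv (w n i) g / 2) - psi (e i v) + 2 * phi (e i v))) <=
      - (C1 / 4) * \sum_(i < n) dotcv (w n i) g ^+ 2 +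
      (kappa * delta * tau + c / 4) * n%:R}.
  (* The net does not depend on n, so finitely many almost sure events are intersected, by induction
     on it. *)
  have c4_gt0 : 0 < c / 4 by rewrite divr_gt0.
  elim: net net_delta {net_eta} => [_|g s IH net_delta].
    by apply: aeW => v; apply: nearW.
  have s_delta g' : g' \in s -> forall k, `|g' k 0| <= delta.
    by move=> g's; apply: net_delta; rewrite inE g's orbT.
  have tA n i : (n1 <= n)%N -> (i < n)%N -> `|dotcv (w n i) g| <= kappa * delta.
    move=> n1n i_n.
    apply: le_trans (normr_dotcv_le (a := K) (fun k => wK n i k n1n i_n)
      (net_delta g (mem_head _ _))) _.
    by rewrite ler_wpM2r ?(ltW delta_gt0)// ler_wpDr// ler_wpM2l// ler_norm.
  have := score_sum_le indep ident nondec incr C0_gt0 intpsi psi0 drift M_gt0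
    kd_gt0 kdD c4_gt0 truncM tA.
  apply: filterS2 (IH s_delta) => v; apply: filterS2 => n Hs Hg g'.
  by rewrite inE => /predU1P[->//|]; exact: Hs.
have ae_tail : {ae P, forall v, \forall n \near \oo,
    \sum_(i < n) `|psi (e i v) - phi (e i v)| <= 4 * tau * n%:R}.
  apply: (iid_sum_le (f := fun y => `|psi y - phi y|)) => //.
  - apply: measurableT_comp => //; apply: measurable_funB => //.
    by apply: measurable_maxr => //; exact: measurable_minr.
  - have mphi : measurable_fun setT phi.
      by apply: measurable_maxr => //; exact: measurable_minr.
    apply: (integrable_norm (f := fun v => psi (e 0%N v) - phi (e 0%N v))).
    apply: integrable_realB => //; apply: (@bounded_integrable _ _ _ P _ M).
      exact: (measurableT_comp mphi).
    move=> v; rewrite ler_norml /phi le_max lexx /= ge_max ge_min lexx orbT andbT.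
    by rewrite (le_trans _ (ltW M_gt0))// oppr_le0 ltW.
have ae_L : {ae P, forall v, \forall n \near \oo,
    \sum_(i < n) `|psi (e i v)| <= L * n%:R}.
  apply: (iid_sum_le (f := fun y => `|psi y|)) => //.
  - exact: measurableT_comp.
  - exact: (integrable_norm intpsi).
  - by rewrite lerDl.
  - by rewrite ltr_wpDl// Rintegral_ge0.
move: ae_net; apply: filterS3 ae_tail ae_L => v tail_v L_v net_v.
near=> n => u Fu k.
apply: (@lt_le_trans _ _ delta); last by rewrite ge_min lexx.
have n1n : (n1 <= n)%N by near: n; exact: nbhs_infty_ge.
apply: (M_estimate_close (n := n) (w := w n) (y := fun i => e i v) (psi := psi) (phi := phi)
  (net := net) (Delta := Delta) (C0 := C0) (C1 := C1) (K := `|K|) (kappa := kappa)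
  (eta := eta) (r := kappa * delta * tau + c / 4) (tau := 4 * tau) (L := L)) => //.
- by move=> i k' i_n; rewrite (le_trans (wK n i k' n1n i_n))// ler_norm.
- by rewrite /kappa lerDl.
- by move=> z; exact: gramw.
- by near: n; exact: nbhs_infty_gt.
- by rewrite ge_min lexx.
- by near: n.
- by near: n.
- by near: n.
- have -> : kappa * delta * (4 * tau) = 4 * (kappa * delta * tau) by ring.
  rewrite tauE -/c; lra.
Unshelve. all: by end_near. Qed.

End robust_regression.

(** * Return to the original coordinates *)

Theorem theorem1 (R : realType) (d : measure_display) (T : measurableType d)
    (P : probability T R) (p : nat)
    (x : nat -> 'cV[R]_p) (beta0 : 'cV[R]_p)
    (e : nat -> {RV P >-> R}) (Y : nat -> T -> R)
    (rho psi_m psi_p psi : R -> R) (n0 : nat) (Delta C0 C1 : R)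
    (betahat : nat -> T -> 'cV[R]_p)
    (e_indep : mutually_independent e)
    (e_ident : identically_distributed e)
    (Y_model : forall i w, Y i w = dotcv (x i) beta0 + e i w)
    (rho_convex : @convex_function R R^o setT rho)
    (rho_nonmonotonic : ~ (nondecreasing_fun rho \/ nonincreasing_fun rho))
    (psi_m_left : is_left_derivative rho psi_m)
    (psi_p_right : is_right_derivative rho psi_p)
    (psi_between : forall u, psi_m u <= psi u <= psi_p u)
    (S_posdef : posdefmx (gram x n0))
    (Delta_gt0 : 0 < Delta) (C0_gt0 : 0 < C0) (C1_gt0 : 0 < C1)
    (psi_incr : forall h u : R, 0 < h < Delta -> psi (u + h) - psi u <= C0)
    (Epsi0 : ('E_P [fun w => psi (e 0%N w)] = 0)%E)
    (Epsi_ge : forall u : R, `|u| < Delta ->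
      ((C1 * `|u|)%:E <= `| 'E_P [fun w => psi (e 0%N w + u)%R] |)%E)
    (d_bigO : (max_leverage x : nat -> R^o) =O_\oo (fun n => n%:R^-1 : R^o))
    (betahat_M : forall n w, (n0 <= n)%N ->
      is_M_estimate rho x (fun i => Y i w) n (betahat n w)) :
  {ae P, forall w, (fun n => betahat n w) @ \oo --> beta0}.
Proof.
have sub := convex_subgradient rho_convex psi_m_left psi_p_right psi_between.
have [C C_gt0 [N _ levC]] : exists2 C : R, 0 < C & \forall n \near \oo,
    max_leverage x n <= C / n%:R.
  have /eqO_exP[C C_gt0 leC] := d_bigO.
  exists C => //; apply: filterS leC => n.
  rewrite [X in _ * X]ger0_norm ?invr_ge0//; apply: le_trans.
  exact: ler_norm.
(* From n1 on the Gram matrix is positive definite, the leverage bound holds and n is positive;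
   below it the coordinates get dummy values. *)
pose n1 := maxn (maxn n0 N) 1.
have n1n0 n : (n1 <= n)%N -> (n0 <= n)%N by rewrite !geq_max => /andP[/andP[]].
have /choice[w /choice[U wU]] : forall n, exists (w : nat -> 'cV[R]_p) (U : 'M[R]_p),
    (n1 <= n)%N ->
    [/\ forall i v, dotcv (w i) (U *m v) = dotcv (x i) v,
      forall v, \sum_(i < n) dotcv (w i) v ^+ 2 = n%:R * dotcv v v &
      forall i, (i < n)%N -> dotcv (w i) (w i) <= C].
  move=> n; have [n1n|n1n] := leqP n1 n; last by exists (fun=> 0), 0.
  have := n1n; rewrite /n1 !geq_max => /andP[/andP[n0n Nn] n_gt0].
  have [v [U vU]] := normalized_design n_gt0 (gram_posdef n0n S_posdef) (levC n Nn).
  by exists v, U.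
have wK n i k : (n1 <= n)%N -> (i < n)%N -> `|w n i k 0| <= C + 1.
  move=> n1n i_n; have [_ _ /(_ i i_n)] := wU n n1n.
  rewrite dotcvE (bigD1 k)//= => wC.
  have : `|w n i k 0| ^+ 2 <= C.
    rewrite real_normK ?num_real// expr2; apply: le_trans wC.
    by rewrite lerDl sumr_ge0// => j _; rewrite -expr2 sqr_ge0.
  by have := normr_ge0 (w n i k 0); nra.
have gramw n v : (n1 <= n)%N -> \sum_(i < n) dotcv (w n i) v ^+ 2 = n%:R * dotcv v v.
  by move=> n1n; have [_ ->] := wU n n1n.
have [c c_gt0 coercive] := gram_coercive S_posdef.
(* The countably many radii 1 / (m + 1) share one null set. *)
have /ae_foralln : forall m, {ae P, forall v, \forall n \near \oo, forall u : 'cV[R]_p,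
    \sum_(i < n) rho (e i v - dotcv (w n i) u) <= \sum_(i < n) rho (e i v) ->
    forall k, `|u k 0| < m.+1%:R^-1}.
  move=> m; apply: (normalized_consistency e_indep e_ident sub Delta_gt0 C0_gt0
    C1_gt0 psi_incr Epsi0 Epsi_ge wK gramw).
  by rewrite invr_gt0.
apply: filterS => v close; apply/cvg_ballP => eps eps_gt0.
pose b := c * (p%:R * (C + 1)) + 1.
have b_gt0 : 0 < b.
  by rewrite ltr_wpDl// mulr_ge0 ?(ltW c_gt0)// mulr_ge0// addr_ge0// ltW.
pose m := Num.truncn (b / eps).
have bm : b * m.+1%:R^-1 < eps.
  by rewrite ltr_pdivrMr// mulrC -ltr_pdivrMr// truncnS_gt.
near=> n.
have n1n : (n1 <= n)%N by near: n; exact: nbhs_infty_ge.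
have [wUE _ _] := wU n n1n.
pose h := betahat n v - beta0.
have hU k : `|(U n *m h) k 0| < m.+1%:R^-1.
  have close_n : forall u : 'cV[R]_p,
      \sum_(i < n) rho (e i v - dotcv (w n i) u) <= \sum_(i < n) rho (e i v) ->
      forall k, `|u k 0| < m.+1%:R^-1 by near: n; exact: close.
  apply: close_n; have := betahat_M n v (n1n0 n n1n) beta0; rewrite /M_objective.
  congr (_ <= _); apply: eq_bigr => i _; congr (rho _); rewrite Y_model.
    by rewrite wUE /h dotcvBr; ring.
  by rewrite addrAC subrr add0r.
(* Only the indices i < n0 are used, so c does not depend on n although [w n] and [U n] do. *)
have hk k : `|h k 0| <= c * (p%:R * (C + 1) * m.+1%:R^-1).
  apply: coercive; first by rewrite !mulr_ge0// ?invr_ge0// addr_ge0// ltW.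
  move=> i i_n0; rewrite -wUE; apply: normr_dotcv_le => k'.
    by apply: wK => //; rewrite (leq_trans i_n0)// n1n0.
  exact: ltW.
split=> // k j; rewrite (ord1 j) /ball /= distrC.
have -> : betahat n v k 0 - beta0 k 0 = h k 0 by rewrite !mxE.
apply: le_lt_trans (hk k) (le_lt_trans _ bm).
rewrite !mulrA ler_wpM2r ?invr_ge0//.
by rewrite /b mulrA lerDl.
Unshelve. all: by end_near. Qed.
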